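(* Let $(M,g)$ be a four-dimensional spacetime whose Weyl tensor $C_{abcd}$ is non-zero at every point. If $(M,g)$ is conformally semi-symmetric, i.e. $\nabla_{[a}\nabla_{b]}C_{cdef}=0$, then it is Ricci semi-symmetric, i.e. $\nabla_{[a}\nabla_{b]}R_{cd}=0$.
   Context: A spacetime is a smooth 4-dimensional Lorentzian manifold $(M,g)$, with Levi-Civita connection $\nabla$, Riemann tensor $R_{abcd}$, Ricci tensor $R_{ab}=R^c{}_{acb}$ and Weyl tensor $C_{abcd}$ (the totally trace-free part of the Riemann tensor). Square brackets enclosing indices denote antisymmetrization. *)

(* Defs.v *)
From HB Require Import structures.
From mathcomp Require Import all_boot all_order all_algebra.
From mathcomp Require Import all_classical all_reals all_analysis.

Set Implicit Arguments.
Unset Strict Implicit.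
Unset Printing Implicit Defensive.

Import Order.TTheory GRing.Theory Num.Theory.
Import numFieldNormedType.Exports.

Local Open Scope classical_set_scope.
Local Open Scope ring_scope.

(* MathComp-Analysis has no smooth manifolds.  A manifold is given here by a
   smooth atlas with charts in 'rV[R]_4, and a metric by its component matrices
   in the charts, subject to the tensor transformation law.  The curvature
   tensors are computed in each chart from the components of the metric;
   statements about them are required in every chart around every point. *)

Section Smooth.
Context {R : realType}.

Definition partial (i : 'I_4) (f : 'rV[R]_4 -> R) : 'rV[R]_4 -> R :=
  fun x => 'D_(delta_mx 0 i) f x.

(* C^k on an open set U: the iterated partial derivatives of order at most k
   exist and are continuous on U. *)
Fixpoint Ck_on (k : nat) (U : set 'rV[R]_4) (f : 'rV[R]_4 -> R) : Prop :=
  (forall x, U x -> {for x, continuous f}) /\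
  (if k is k'.+1 then
     forall i : 'I_4, (forall x, U x -> derivable f x (delta_mx 0 i)) /\
                      Ck_on k' U (partial i f)
   else True).

Definition smooth_on (U : set 'rV[R]_4) (f : 'rV[R]_4 -> R) : Prop :=
  forall k, Ck_on k U f.

End Smooth.

(* chart_map and chart_inv are total functions; their values outside
   chart_dom and chart_im are irrelevant. *)
Record chart (R : realType) (M : topologicalType) := Chart {
  chart_dom : set M;
  chart_im : set 'rV[R]_4;
  chart_map : M -> 'rV[R]_4;
  chart_inv : 'rV[R]_4 -> M;
  chart_dom_open : open chart_dom;
  chart_im_open : open chart_im;
  chart_map_im : forall p, chart_dom p -> chart_im (chart_map p);
  chart_inv_dom : forall x, chart_im x -> chart_dom (chart_inv x);
  chart_mapK : forall p, chart_dom p -> chart_inv (chart_map p) = p;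
  chart_invK : forall x, chart_im x -> chart_map (chart_inv x) = x;
  chart_map_cts : forall p, chart_dom p -> {for p, continuous chart_map};
  chart_inv_cts : forall x, chart_im x -> {for x, continuous chart_inv}
}.

Section Transition.
Context {R : realType} {M : topologicalType}.
Implicit Types c d : chart R M.

Definition overlap c d : set 'rV[R]_4 :=
  [set x | chart_im c x /\ chart_dom d (chart_inv c x)].

Definition transition c d : 'rV[R]_4 -> 'rV[R]_4 :=
  fun x => chart_map d (chart_inv c x).

End Transition.

Record manifold (R : realType) := Manifold {
  carrier :> topologicalType;
  atlas : set (chart R carrier);
  manifold_hausdorff : hausdorff_space carrier;
  manifold_second_countable : @second_countable carrier;
  atlas_cover : forall p : carrier, exists2 c, atlas c & chart_dom c p;
  atlas_smooth : forall c d, atlas c -> atlas d ->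
    forall i : 'I_4, smooth_on (overlap c d) (fun x => transition c d x 0 i)
}.

(* diag(-1,1,1,1) *)
Definition minkowski (R : realType) : 'M[R]_4 :=
  \matrix_(i, j) (if i == j then (if i == 0 then -1 else 1) else 0).

(* G is symmetric of signature (-,+,+,+) or (+,-,-,-), i.e. it has an
   orthonormal basis (the rows of P); both sign conventions are admitted. *)
Definition lorentzian (R : realType) (G : 'M[R]_4) : Prop :=
  G^T = G /\
  exists2 P : 'M[R]_4, P \in unitmx &
    P *m G *m P^T = minkowski R \/ P *m G *m P^T = - minkowski R.

(* metric_mx g c x is the matrix of components of the metric in the chart c at
   the point with coordinates x.  Row i of the library's jacobian 'J phi x is
   the i-th partial derivative of phi, so metric_transform reads
   g_ij = (d_i phi^k) (d_j phi^l) g'_kl. *)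
Record lorentz_metric (R : realType) (M : manifold R) := LorentzMetric {
  metric_mx :> chart R M -> 'rV[R]_4 -> 'M[R]_4;
  metric_smooth : forall c, atlas c ->
    forall i j : 'I_4, smooth_on (chart_im c) (fun x => metric_mx c x i j);
  metric_lorentzian : forall c, atlas c ->
    forall x, chart_im c x -> lorentzian (metric_mx c x);
  metric_transform : forall c d, atlas c -> atlas d ->
    forall x, overlap c d x ->
      metric_mx c x = 'J (transition c d) x
                        *m metric_mx d (transition c d x)
                        *m ('J (transition c d) x)^T
}.

(* The components, in one chart, of a covariant tensor field of rank k. *)
Definition components (R : realType) (k : nat) : Type :=
  k.-tuple 'I_4 -> 'rV[R]_4 -> R.

Definition subst_index (k : nat) (J : k.-tuple 'I_4) (m : 'I_k) (e : 'I_4) :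
    k.-tuple 'I_4 :=
  [tuple if j == m then e else tnth J j | j < k].

Section Curvature.
Context {R : realType}.
Variable g : 'rV[R]_4 -> 'M[R]_4.

(* g_ab and its inverse g^ab *)
Definition gdn (a b : 'I_4) (x : 'rV[R]_4) : R := g x a b.
Definition gup (a b : 'I_4) (x : 'rV[R]_4) : R := invmx (g x) a b.

(* Gamma^c_ab of the Levi-Civita connection *)
Definition christoffel (c a b : 'I_4) (x : 'rV[R]_4) : R :=
  2^-1 * \sum_(d < 4) gup c d x *
    (partial a (gdn d b) x + partial b (gdn d a) x - partial d (gdn a b) x).

(* (nabla T) [a, i_1, ..., i_k] = nabla_a T_{i_1 ... i_k}: the new index comes
   first, so (nabla (nabla T)) [a, b, ...] = nabla_a nabla_b T_... *)
Definition nabla (k : nat) (T : components R k) : components R k.+1 :=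
  fun I x =>
    let a := thead I in
    let J : k.-tuple 'I_4 := behead_tuple I in
    partial a (T J) x
    - \sum_(m < k) \sum_(e < 4)
        christoffel e a (tnth J m) x * T (subst_index J m e) x.

(* R^a_bcd, with (nabla_c nabla_d - nabla_d nabla_c) V^a = R^a_bcd V^b *)
Definition riemann_up (a b c d : 'I_4) (x : 'rV[R]_4) : R :=
  partial c (christoffel a d b) x - partial d (christoffel a c b) x
  + \sum_(e < 4) (christoffel a c e x * christoffel e d b x
                  - christoffel a d e x * christoffel e c b x).

Definition riemann (a b c d : 'I_4) (x : 'rV[R]_4) : R :=
  \sum_(e < 4) gdn a e x * riemann_up e b c d x.

(* R_ab = R^c_acb *)
Definition ricci (a b : 'I_4) (x : 'rV[R]_4) : R :=
  \sum_(c < 4) riemann_up c a c b x.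

Definition scalar_curvature (x : 'rV[R]_4) : R :=
  \sum_(a < 4) \sum_(b < 4) gup a b x * ricci a b x.

(* The totally trace-free part of the Riemann tensor in dimension 4. *)
Definition weyl (a b c d : 'I_4) (x : 'rV[R]_4) : R :=
  riemann a b c d x
  - 2^-1 * (gdn a c x * ricci b d x - gdn a d x * ricci b c x
            - gdn b c x * ricci a d x + gdn b d x * ricci a c x)
  + 6^-1 * scalar_curvature x *
      (gdn a c x * gdn b d x - gdn a d x * gdn b c x).

Definition ricci_tensor : components R 2 :=
  fun I => ricci (tnth I 0) (tnth I 1).

Definition weyl_tensor : components R 4 :=
  fun I => weyl (tnth I 0) (tnth I 1) (tnth I 2) (tnth I 3).

(* nabla_[a nabla_b] T_I, with the usual normalization factor 1/2 *)
Definition nabla_antisym (k : nat) (T : components R k)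
    (a b : 'I_4) (I : k.-tuple 'I_4) (x : 'rV[R]_4) : R :=
  2^-1 * (nabla (nabla T) [tuple of a :: [tuple of b :: I]] x
          - nabla (nabla T) [tuple of b :: [tuple of a :: I]] x).

End Curvature.

Section Spacetime.
Context {R : realType} {M : manifold R}.
Variable g : lorentz_metric M.

Definition weyl_nonzero_everywhere : Prop :=
  forall (p : M) (c : chart R M), atlas c -> chart_dom c p ->
    exists I : 4.-tuple 'I_4, weyl_tensor (g c) I (chart_map c p) <> 0.

Definition conformally_semi_symmetric : Prop :=
  forall (p : M) (ch : chart R M), atlas ch -> chart_dom ch p ->
    forall a b c d e f : 'I_4,
      nabla_antisym (g ch) (weyl_tensor (g ch)) a b [tuple c; d; e; f]
        (chart_map ch p) = 0.

Definition ricci_semi_symmetric : Prop :=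
  forall (p : M) (ch : chart R M), atlas ch -> chart_dom ch p ->
    forall a b c d : 'I_4,
      nabla_antisym (g ch) (ricci_tensor (g ch)) a b [tuple c; d]
        (chart_map ch p) = 0.

End Spacetime.

(* Main.v *)
Require Import Defs.
From mathcomp Require Import all_boot all_order all_algebra.
From mathcomp Require Import all_classical all_reals all_analysis.
From mathcomp Require Import complex.
From mathcomp Require Import ring lra.

(** The statement is pointwise once the Ricci identity is available: for every
    tensor [T], the antisymmetrized second derivative of [T] is, up to the
    factor -1/2, the action on [T] of the curvature endomorphisms
    [A_ab = (R^e_iab)_ei] as derivations of the tensor algebra
    ([ricci_identity]).  Each [A_ab] is skew-adjoint for the metric, so it lies
    in the Lorentz Lie algebra.  The hypothesis says that every [A_ab]
    annihilates the Weyl tensor [C], and the conclusion that every [A_ab]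
    annihilates the Ricci tensor.

    The heart of the matter is that in Lorentzian signature the stabilizer of a
    nonzero Weyl tensor in the Lorentz algebra is commutative
    ([stabilizer_commute]).  The Lorentz algebra is so(3,C): an element with
    boost part [e] and rotation part [b] is the complex vector [e + ib], the
    bracket being the cross product up to sign; a Weyl tensor is a complex
    symmetric trace-free matrix [Q = E + iB] of size 3; and if [f] annihilates
    [Q] then [Q] commutes with the matrix of the cross product with [f]
    ([cross_mx_cmatC]).  If [f] and [h] both commute with [Q] in this sense and
    [n = f x h] is nonzero, then [Qn = 0] and [n x Q = 0], so [Q] is a multiple
    of [n n^T]; if [Q] is nonzero, invariance under [f] and [h] gives
    [f x n = h x n = 0], so [f] and [h] are both parallel to [n] and
    [f x h = 0], a contradiction ([commuting_cross_mx_parallel]).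

    Hence all the [A_ab] commute.  In the expression of [A_ab] applied to the
    Riemann tensor [R_pcqd], the terms where [A_ab] hits [p] or [c] add up to
    the commutator of [A_ab] and [A_qd], and by pair symmetry those where it
    hits [q] or [d] to the commutator of [A_ab] and [A_pc]; so [A_ab]
    annihilates the Riemann tensor ([curvature_act_riemann]), and also its
    contraction, the Ricci tensor.

    The analytic part consists of the symmetry of second partial derivatives
    ([partialC]) and of the usual symmetries of the Riemann tensor.  The
    antisymmetry of [R_abcd] in [a], [b] is the Ricci identity applied to the
    metric itself, which is parallel ([nabla_metric]). *)

Set Implicit Arguments.
Unset Strict Implicit.
Unset Printing Implicit Defensive.

Import Order.TTheory GRing.Theory Num.Theory.
Import numFieldNormedType.Exports.

Local Open Scope classical_set_scope.
Local Open Scope ring_scope.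

(** * Functions of class C^k and symmetry of second derivatives *)

Section CkFunctions.
Context {R : realType}.
Implicit Types (U : set 'rV[R]_4) (f g : 'rV[R]_4 -> R).

Lemma near_eq_on U f g x : open U -> (forall y, U y -> f y = g y) -> U x ->
  \near x, f x = g x.
Proof.
move=> oU fg Ux; near=> y; apply: fg; near: y.
exact: open_nbhs_nbhs.
Unshelve. all: by end_near. Qed.

Lemma eq_partial_on U f g i x : open U -> (forall y, U y -> f y = g y) ->
  U x -> partial i f x = partial i g x.
Proof. by move=> oU fg Ux; apply: near_eq_derive; apply: near_eq_on Ux. Qed.

Lemma Ck_on_eq k U f g : open U -> (forall y, U y -> f y = g y) ->
  Ck_on k U f -> Ck_on k U g.
Proof.
move=> oU.
have cts f1 f2 x : (forall y, U y -> f1 y = f2 y) -> U x ->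
    {for x, continuous f1} -> {for x, continuous f2}.
  move=> f12 Ux; rewrite /prop_for /continuous_at -(f12 x Ux).
  have nf := near_eq_on oU f12 Ux.
  by apply: cvg_trans; exact: near_eq_cvg nf.
elim: k f g => [|k IH] f g fg [cf df].
  by split=> // x Ux; apply: cts (cf x Ux).
split=> [x Ux|i]; first by apply: cts (cf x Ux).
have [dfi Cfi] := df i; split=> [x Ux|].
  by apply: near_eq_derivable (dfi x Ux); apply: near_eq_on Ux.
by apply: IH Cfi => y Uy; apply: eq_partial_on Uy.
Qed.

Lemma Ck_onW k U f : Ck_on k.+1 U f -> Ck_on k U f.
Proof.
elim: k f => [|k IH] f [cf df]; split=> // i.
by have [dfi Cfi] := df i; split=> //; apply: IH.
Qed.

Lemma Ck_on_cst k U (r : R) : open U -> Ck_on k U (fun=> r).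
Proof.
move=> oU; elim: k r => [|k IH] r; first by split=> // x _; exact: cst_continuous.
split=> [x _|i]; first exact: cst_continuous.
split=> [x _|]; first exact: derivable_cst.
have := IH 0; apply: Ck_on_eq => // y _.
by rewrite /partial derive_cst.
Qed.

Lemma partialD i f g x : derivable f x (delta_mx 0 i) ->
  derivable g x (delta_mx 0 i) ->
  partial i (fun y => f y + g y) x = partial i f x + partial i g x.
Proof. exact: deriveD. Qed.

Lemma partialM i f g x : derivable f x (delta_mx 0 i) ->
  derivable g x (delta_mx 0 i) ->
  partial i (fun y => f y * g y) x = f x * partial i g x + g x * partial i f x.
Proof. exact: deriveM. Qed.

Lemma Ck_onD k U f g : open U -> Ck_on k U f -> Ck_on k U g ->
  Ck_on k U (fun x => f x + g x).
Proof.
move=> oU; elim: k f g => [|k IH] f g [cf df] [cg dg].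
  by split=> // x Ux; exact: continuousD (cf x Ux) (cg x Ux).
split=> [x Ux|i]; first exact: continuousD (cf x Ux) (cg x Ux).
have [dfi Cfi] := df i; have [dgi Cgi] := dg i; split=> [x Ux|].
  by apply: derivableD; [exact: dfi | exact: dgi].
apply: Ck_on_eq (IH _ _ Cfi Cgi) => // y Uy.
by rewrite partialD; [| exact: dfi | exact: dgi].
Qed.

Lemma Ck_onM k U f g : open U -> Ck_on k U f -> Ck_on k U g ->
  Ck_on k U (fun x => f x * g x).
Proof.
move=> oU; elim: k f g => [|k IH] f g Cf Cg.
  have [[cf _] [cg _]] := (Cf, Cg).
  by split=> // x Ux; exact: continuousM (cf x Ux) (cg x Ux).
have [[cf df] [cg dg]] := (Cf, Cg).
split=> [x Ux|i]; first exact: continuousM (cf x Ux) (cg x Ux).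
have [dfi Cfi] := df i; have [dgi Cgi] := dg i; split=> [x Ux|].
  by apply: derivableM; [exact: dfi | exact: dgi].
have C := Ck_onD oU (IH _ _ (Ck_onW Cf) Cgi) (IH _ _ (Ck_onW Cg) Cfi).
apply: Ck_on_eq C => // y Uy.
by rewrite partialM; [| exact: dfi | exact: dgi].
Qed.

(** The derivative of [f^-1] is [- f^-1 * f^-1 * f'], whose regularity is that
    of [f^-1] one order below: hence the induction on [k]. *)
Lemma Ck_onV k U f : open U -> (forall x, U x -> f x != 0) -> Ck_on k U f ->
  Ck_on k U (fun x => (f x)^-1).
Proof.
move=> oU f0; elim: k => [|k IH] Cf; have [cf df] := Cf.
  by split=> // x Ux; apply: continuousV; [exact: f0 | exact: (cf x Ux)].
split=> [x Ux|i]; first by apply: continuousV; [exact: f0 | exact: (cf x Ux)].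
have [dfi Cfi] := df i; split=> [x Ux|].
  by apply: derivableV; [exact: f0 | exact: dfi].
have CV := IH (Ck_onW Cf).
have C := Ck_onM oU (Ck_onM oU (Ck_on_cst k (-1) oU) (Ck_onM oU CV CV)) Cfi.
apply: Ck_on_eq C => // y Uy.
rewrite /partial deriveV; [|exact: f0|exact: dfi].
by rewrite mulN1r -invfM -expr2.
Qed.

Lemma smooth_on_eq U f g : open U -> (forall y, U y -> f y = g y) ->
  smooth_on U f -> smooth_on U g.
Proof. by move=> oU fg Cf k; apply: Ck_on_eq (Cf k). Qed.

Lemma smooth_on_cst U (r : R) : open U -> smooth_on U (fun=> r).
Proof. by move=> oU k; apply: Ck_on_cst. Qed.

Lemma smooth_onD U f g : open U -> smooth_on U f -> smooth_on U g ->
  smooth_on U (fun x => f x + g x).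
Proof. by move=> oU Cf Cg k; apply: Ck_onD. Qed.

Lemma smooth_onM U f g : open U -> smooth_on U f -> smooth_on U g ->
  smooth_on U (fun x => f x * g x).
Proof. by move=> oU Cf Cg k; apply: Ck_onM. Qed.

Lemma smooth_onN U f : open U -> smooth_on U f -> smooth_on U (fun x => - f x).
Proof.
move=> oU Cf; have := smooth_onM oU (smooth_on_cst (-1) oU) Cf.
by apply: smooth_on_eq => // y _; rewrite mulN1r.
Qed.

Lemma smooth_onB U f g : open U -> smooth_on U f -> smooth_on U g ->
  smooth_on U (fun x => f x - g x).
Proof. by move=> oU Cf Cg; apply: smooth_onD => //; apply: smooth_onN. Qed.

Lemma smooth_onV U f : open U -> (forall x, U x -> f x != 0) ->
  smooth_on U f -> smooth_on U (fun x => (f x)^-1).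
Proof. by move=> oU f0 Cf k; apply: Ck_onV. Qed.

Lemma smooth_on_partial U f i : smooth_on U f -> smooth_on U (partial i f).
Proof. by move=> Cf k; case: (Cf k.+1) => _ /(_ i)[]. Qed.

Lemma smooth_on_derivable U f i x : smooth_on U f -> U x ->
  derivable f x (delta_mx 0 i).
Proof. by move=> Cf Ux; case: (Cf 1%N) => _ /(_ i)[/(_ x Ux)]. Qed.

Lemma smooth_on_continuous U f x : smooth_on U f -> U x ->
  {for x, continuous f}.
Proof. by move=> Cf Ux; case: (Cf 0%N) => /(_ x Ux). Qed.

Lemma smooth_on_sum (I : Type) (r : seq I) (P : pred I) U
    (F : I -> 'rV[R]_4 -> R) : open U ->
  (forall i, smooth_on U (F i)) ->
  smooth_on U (fun x => \sum_(i <- r | P i) F i x).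
Proof.
move=> oU CF; elim: r => [|i r IH].
  by have := smooth_on_cst 0 oU; apply: smooth_on_eq => // y _; rewrite big_nil.
case Pi : (P i).
  have := smooth_onD oU (CF i) IH; apply: smooth_on_eq => // y _.
  by rewrite big_cons Pi.
by move: IH; apply: smooth_on_eq => // y _; rewrite big_cons Pi.
Qed.

Lemma smooth_on_prod (I : Type) (r : seq I) (P : pred I) U
    (F : I -> 'rV[R]_4 -> R) : open U ->
  (forall i, smooth_on U (F i)) ->
  smooth_on U (fun x => \prod_(i <- r | P i) F i x).
Proof.
move=> oU CF; elim: r => [|i r IH].
  by have := smooth_on_cst 1 oU; apply: smooth_on_eq => // y _; rewrite big_nil.
case Pi : (P i).
  have := smooth_onM oU (CF i) IH; apply: smooth_on_eq => // y _.
  by rewrite big_cons Pi.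
by move: IH; apply: smooth_on_eq => // y _; rewrite big_cons Pi.
Qed.

Lemma smooth_on_det n U (A : 'rV[R]_4 -> 'M[R]_n) : open U ->
  (forall i j, smooth_on U (fun x => A x i j)) ->
  smooth_on U (fun x => \det (A x)).
Proof.
move=> oU CA; rewrite /determinant; apply: smooth_on_sum => // s.
apply: smooth_onM => //; first exact: smooth_on_cst.
exact: smooth_on_prod.
Qed.

Lemma smooth_on_invmx n U (A : 'rV[R]_4 -> 'M[R]_n) i j : open U ->
  (forall x, U x -> A x \in unitmx) ->
  (forall i j, smooth_on U (fun x => A x i j)) ->
  smooth_on U (fun x => invmx (A x) i j).
Proof.
move=> oU uA CA.
(* Cramer's formula, which gives invmx where A x is invertible. *)
have C : smooth_on U (fun x => (\det (A x))^-1 * cofactor (A x) j i).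
  apply: smooth_onM => //.
    apply: smooth_onV => //; last exact: smooth_on_det.
    by move=> x /uA; rewrite unitmxE unitfE.
  apply: smooth_onM => //; first exact: smooth_on_cst.
  apply: smooth_on_det => // k l.
  have := CA (lift j k) (lift i l).
  by apply: smooth_on_eq => // y _; rewrite !mxE.
by apply: smooth_on_eq C => // x Ux; rewrite /invmx (uA _ Ux) !mxE.
Qed.

Lemma is_derive_line f (x u v : 'rV[R]_4) (s : R) (w : 'rV[R]_4) :
  w = x + s *: u -> derivable f w u ->
  is_derive s 1 (fun t : R => f (x + t *: u)) ('D_u f w).
Proof.
move=> -> df.
have E : (fun h : R => h^-1 *: (f (h *: u + (x + s *: u)) - f (x + s *: u))) =
  (fun h : R => h^-1 *: (f (x + (h *: 1 + s) *: u) - f (x + s *: u))).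
  apply/funext => h; congr (_ *: (f _ - _)).
  by rewrite [h *: 1]mulr1 scalerDl addrCA.
by apply: DeriveDef; rewrite /derivable /derive /= -E.
Qed.

Lemma MVT_derivable (phi dphi : R -> R) (h : R) : 0 < h ->
  (forall s, 0 <= s <= h -> is_derive s 1 phi (dphi s)) ->
  exists2 s, 0 <= s <= h & phi h - phi 0 = h * dphi s.
Proof.
move=> h0 dP.
have dPo s : s \in `]0, h[ -> is_derive s 1 phi (dphi s).
  by rewrite in_itv /= => /andP[s0 s1]; apply: dP; rewrite !ltW.
have cP : {within `[0, h], continuous phi}.
  apply: derivable_within_continuous => s; rewrite in_itv /= => hs.
  by have [] := dP s hs.
have [s sh ->] := MVT h0 dPo cP.
exists s; last by rewrite subr0 mulrC.
by move: sh; rewrite in_itv /= => /andP[? ?]; rewrite !ltW.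
Qed.

(** The second difference of [f] over the parallelogram with sides [h u] and
    [h v] is [h^2] times a mixed second derivative at some point of it: the
    mean value theorem is applied along [u] and then along [v]. *)
Lemma second_difference U f (x u v : 'rV[R]_4) (h : R) : 0 < h ->
  (forall s t, 0 <= s <= h -> 0 <= t <= h -> U (x + s *: u + t *: v)) ->
  (forall y, U y -> derivable f y u) ->
  (forall y, U y -> derivable ('D_u f) y v) ->
  exists s t, [/\ 0 <= s <= h, 0 <= t <= h &
    f (x + h *: u + h *: v) - f (x + h *: u) - (f (x + h *: v) - f x) =
    h ^+ 2 * 'D_v ('D_u f) (x + s *: u + t *: v)].
Proof.
move=> h0 box du dvu.
have hh : 0 <= h <= h by rewrite ltW //= lexx.
have h00 : 0 <= (0 : R) <= h by rewrite lexx ltW.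
pose phi s := f (x + h *: v + s *: u) - f (x + s *: u).
pose dphi s := 'D_u f (x + s *: u + h *: v) - 'D_u f (x + s *: u).
have dP s : 0 <= s <= h -> is_derive s 1 phi (dphi s).
  move=> hs; apply: is_deriveB.
    apply: (@is_derive_line _ _ _ v); first by rewrite addrAC.
    exact: du (box _ _ hs hh).
  apply: (@is_derive_line _ _ _ v) => //.
  by apply: du; have := box s 0 hs h00; rewrite scale0r addr0.
have [s hs Es] := MVT_derivable h0 dP.
pose y := x + s *: u.
pose psi t := 'D_u f (y + t *: v).
pose dpsi t := 'D_v ('D_u f) (y + t *: v).
have dP2 t : 0 <= t <= h -> is_derive t 1 psi (dpsi t).
  by move=> ht; apply: (@is_derive_line _ _ _ v) => //; apply: dvu; apply: box.
have [t ht Et] := MVT_derivable h0 dP2.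
exists s, t; split=> //.
move: Es Et; rewrite /phi /dphi /psi /dpsi /y !scale0r !addr0 => Es Et.
by rewrite expr2 -mulrA -Et -Es (addrAC x (h *: v)) opprB; ring.
Qed.

(** Symmetry of second partial derivatives.  Second differences are symmetric
    in the two directions, so both mixed derivatives take the same value at
    two points arbitrarily close to [x], and they are continuous at [x]. *)
Lemma partialC U f i j x : open U -> smooth_on U f -> U x ->
  partial i (partial j f) x = partial j (partial i f) x.
Proof.
move=> oU Cf Ux; apply/eqP/negPn/negP => ne.
pose u : 'rV[R]_4 := delta_mx 0 i; pose v : 'rV[R]_4 := delta_mx 0 j.
pose Dij := partial i (partial j f); pose Dji := partial j (partial i f).
pose e := `|Dij x - Dji x| / 2.
have e0 : 0 < e by rewrite divr_gt0 // normr_gt0 subr_eq0.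
have cij : {for x, continuous Dij}.
  by apply: (smooth_on_continuous (U := U)) => //; do 2!apply: smooth_on_partial.
have cji : {for x, continuous Dji}.
  by apply: (smooth_on_continuous (U := U)) => //; do 2!apply: smooth_on_partial.
have nU : \forall y \near x, U y by exact: open_nbhs_nbhs.
have nij : \forall y \near x, `|Dij x - Dij y| < e.
  by move: cij => /cvgrPdist_lt; apply.
have nji : \forall y \near x, `|Dji x - Dji y| < e.
  by move: cji => /cvgrPdist_lt; apply.
have : \forall y \near x,
    [/\ U y, `|Dij x - Dij y| < e & `|Dji x - Dji y| < e].
  by apply: filterS3 nU nij nji => y.
move=> /nbhs_ballP[d /= d0 B].
(* Small enough for the parallelogram of sides h u and h v to stay in the ball;
   the summand 1 only keeps the denominator positive. *)
pose h := d / (`|u| + `|v| + 1).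
have uv0 : 0 < `|u| + `|v| + 1 by rewrite ltr_wpDl // addr_ge0.
have h0 : 0 < h by rewrite divr_gt0.
have inB s t : 0 <= s <= h -> 0 <= t <= h -> ball x d (x + s *: u + t *: v).
  move=> /andP[s0 sh] /andP[t0 th]; rewrite -ball_normE /=.
  have -> : x - (x + s *: u + t *: v) = - (s *: u + t *: v).
    by rewrite -addrA opprD addNKr.
  rewrite normrN.
  apply: le_lt_trans (ler_normD _ _) _; rewrite !normrZ ger0_norm // ger0_norm //.
  apply: (@le_lt_trans _ _ (h * (`|u| + `|v|))).
    by rewrite mulrDr lerD // ler_wpM2r.
  rewrite [ltRHS](_ : d = h * (`|u| + `|v| + 1)); last first.
    by rewrite /h divfK // gt_eqF.
  by rewrite ltr_pM2l // ltrDl.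
have inU s t : 0 <= s <= h -> 0 <= t <= h -> U (x + s *: u + t *: v).
  by move=> hs ht; have [] := B _ (inB _ _ hs ht).
have inU' s t : 0 <= s <= h -> 0 <= t <= h -> U (x + s *: v + t *: u).
  by move=> hs ht; rewrite addrAC; apply: inU.
have df k y : U y -> derivable f y (delta_mx 0 k).
  exact: smooth_on_derivable.
have ddf k l y : U y -> derivable ('D_(delta_mx 0 k) f) y (delta_mx 0 l).
  by apply: smooth_on_derivable; apply: smooth_on_partial.
have [s [t [hs ht E1]]] := second_difference h0 inU (df i) (ddf i j).
have [s' [t' [hs' ht' E2]]] := second_difference h0 inU' (df j) (ddf j i).
have E : Dji (x + s *: u + t *: v) = Dij (x + s' *: v + t' *: u).
  have h2 : h ^+ 2 != 0 by rewrite expf_neq0 // gt_eqF.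
  apply: (mulfI h2); rewrite -[LHS]E1 -[RHS]E2 (addrAC x (h *: v)).
  by ring.
move: (inB _ _ hs ht) (inB _ _ ht' hs') E; rewrite addrAC (addrAC x (t' *: u)).
set p := (x + t *: v + s *: u); set q := (x + s' *: v + t' *: u) => xp xq E.
have [_ _ b1] := B _ xp; have [_ b2 _] := B _ xq.
have ED : Dij x - Dji x = (Dij x - Dij q) - (Dji x - Dji p).
  by rewrite E opprB addrA subrK.
have : `|Dij x - Dji x| < e + e.
  by rewrite ED; apply: le_lt_trans (ler_normB _ _) (ltrD b2 b1).
by rewrite /e -splitr ltxx.
Qed.

End CkFunctions.

(** * Action of matrices on tensors, and the Ricci identity *)

Lemma exchange_off_diagonal n (V : nmodType) (F : 'I_n -> 'I_n -> V) :
  \sum_(i < n) \sum_(j < n | j != i) F i j =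
  \sum_(i < n) \sum_(j < n | j != i) F j i.
Proof.
rewrite (exchange_big_dep xpredT) //=; apply: eq_bigr => i _.
by apply: eq_bigl => j; rewrite eq_sym.
Qed.

Lemma sum_ord2 (V : nmodType) (F : 'I_2 -> V) : \sum_(i < 2) F i = F 0 + F 1.
Proof.
rewrite !big_ord_recl big_ord0 addr0.
by do ?congr (_ + _); congr F; apply: val_inj.
Qed.

Lemma sum_ord4 (V : nmodType) (F : 'I_4 -> V) :
  \sum_(i < 4) F i = F 0 + F 1 + F 2 + F 3.
Proof.
rewrite !big_ord_recl big_ord0 addr0 !addrA.
by do ?congr (_ + _); congr F; apply: val_inj.
Qed.

Section TensorAction.
Context {R : comPzRingType}.

(** The action on a covariant tensor [T] of the endomorphism with components
    [A e i = A^e_i], as a derivation: [A] is inserted into each slot in turn.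
    The natural action of [A] on covariant tensors is minus this one. *)
Definition act (A : 'I_4 -> 'I_4 -> R) (k : nat) (T : k.-tuple 'I_4 -> R)
    (I : k.-tuple 'I_4) : R :=
  \sum_(m < k) \sum_(e < 4) A e (tnth I m) * T (subst_index I m e).

Lemma tnth_subst_index k (I : k.-tuple 'I_4) m e n :
  tnth (subst_index I m e) n = if n == m then e else tnth I n.
Proof. by rewrite tnth_mktuple. Qed.

Lemma subst_indexC k (I : k.-tuple 'I_4) m n e f : m != n ->
  subst_index (subst_index I m e) n f = subst_index (subst_index I n f) m e.
Proof.
move=> mn; apply: eq_from_tnth => j; rewrite !tnth_subst_index.
by case: eqP => [->|//]; rewrite eq_sym (negbTE mn).
Qed.

Lemma subst_indexK k (I : k.-tuple 'I_4) m e f :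
  subst_index (subst_index I m e) m f = subst_index I m f.
Proof.
by apply: eq_from_tnth => j; rewrite !tnth_subst_index; case: eqP.
Qed.

Lemma subst_index_head k a (I : k.-tuple 'I_4) e :
  subst_index [tuple of a :: I] ord0 e = [tuple of e :: I].
Proof.
apply: eq_from_tnth => j; rewrite tnth_subst_index.
by case: (unliftP ord0 j) => [i ->|->] //=; rewrite !tnthS.
Qed.

Lemma subst_index_behead k a (I : k.-tuple 'I_4) m e :
  subst_index [tuple of a :: I] (lift ord0 m) e =
  [tuple of a :: subst_index I m e].
Proof.
apply: eq_from_tnth => j; rewrite tnth_subst_index.
case: (unliftP ord0 j) => [i ->|->] //=; rewrite !tnthS tnth_subst_index.
by rewrite (inj_eq lift_inj).
Qed.

Lemma behead_tuple_cons k a (I : k.-tuple 'I_4) :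
  behead_tuple [tuple of a :: I] = I.
Proof. exact: val_inj. Qed.

(** The commutator of the actions of two matrices is the action of their
    commutator: the terms in which the two matrices hit different slots
    cancel.  Below, [off] collects these terms and [dg] those in which both hit
    the same slot. *)
Lemma act_commutator k A B (T : k.-tuple 'I_4 -> R) I :
  act A (act B T) I - act B (act A T) I =
  act (fun f i => \sum_(e < 4) (A e i * B f e - B e i * A f e)) T I.
Proof.
pose off A B := \sum_(m < k) \sum_(n < k | n != m) \sum_(e < 4) \sum_(f < 4)
  A e (tnth I m) * B f (tnth I n) * T (subst_index (subst_index I m e) n f).
pose dg A B := \sum_(m < k) \sum_(f < 4) (\sum_(e < 4) A e (tnth I m) * B f e)
  * T (subst_index I m f).
have actact X Y : act X (act Y T) I = dg X Y + off X Y.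
  rewrite /act /dg /off -big_split /=; apply: eq_bigr => m _.
  under eq_bigr => e _.
    rewrite (bigD1 m) //= mulrDr; over.
  rewrite big_split /=; congr (_ + _).
    under eq_bigr do rewrite big_distrr /=.
    rewrite exchange_big /=; apply: eq_bigr => f _.
    rewrite big_distrl /=; apply: eq_bigr => e _.
    by rewrite tnth_subst_index eqxx subst_indexK mulrA.
  under eq_bigr do rewrite big_distrr /=.
  rewrite exchange_big /=; apply: eq_bigr => n nm.
  apply: eq_bigr => e _; rewrite big_distrr /=; apply: eq_bigr => f _.
  by rewrite tnth_subst_index (negbTE nm) mulrA.
have offC : off A B = off B A.
  rewrite /off exchange_off_diagonal.
  apply: eq_bigr => m _; apply: eq_bigr => n nm.
  rewrite exchange_big /=; apply: eq_bigr => f _; apply: eq_bigr => e _.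
  by rewrite subst_indexC // [A _ _ * _]mulrC.
rewrite !actact offC opprD addrACA subrr addr0 /dg /act -sumrB.
apply: eq_bigr => m _; rewrite -sumrB; apply: eq_bigr => f _.
by rewrite -mulrBl -sumrB.
Qed.

Lemma act2 A (t : 'I_4 -> 'I_4 -> R) (I : 2.-tuple 'I_4) :
  act A (fun J => t (tnth J 0) (tnth J 1)) I =
  \sum_(e < 4) A e (tnth I 0) * t e (tnth I 1) +
  \sum_(e < 4) A e (tnth I 1) * t (tnth I 0) e.
Proof.
rewrite /act sum_ord2.
by congr (_ + _); apply: eq_bigr => e _; rewrite !tnth_subst_index.
Qed.

Lemma act4 A (t : 'I_4 -> 'I_4 -> 'I_4 -> 'I_4 -> R) (a b c d : 'I_4) :
  act A (fun J => t (tnth J 0) (tnth J 1) (tnth J 2) (tnth J 3))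
      [tuple a; b; c; d] =
  \sum_(e < 4) (A e a * t e b c d + A e b * t a e c d +
                A e c * t a b e d + A e d * t a b c e).
Proof.
rewrite /act sum_ord4 !big_split /=.
by congr (_ + _ + _ + _); apply: eq_bigr => e _; rewrite !tnth_subst_index.
Qed.

End TensorAction.

Section RicciIdentity.
Context {R : realType}.
Variables (g : 'rV[R]_4 -> 'M[R]_4) (U : set 'rV[R]_4).
Hypothesis oU : open U.

Lemma partial_sum (n : nat) (F : 'I_n -> 'rV[R]_4 -> R) a x :
  (forall i, smooth_on U (F i)) -> U x ->
  partial a (fun y => \sum_(i < n) F i y) x = \sum_(i < n) partial a (F i) x.
Proof.
move=> CF Ux; rewrite -derive_sum; last by move=> i; apply: smooth_on_derivable.
congr ('D_ _ _ _); apply/funext => y.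
by elim/big_rec2: _ => // i y1 y2 _ ->.
Qed.

(* The connection form in the direction a, as a matrix at each point. *)
Let G a x e i := christoffel g e a i x.

Hypothesis smooth_christoffel : forall c a b, smooth_on U (christoffel g c a b).
Hypothesis christoffelC :
  forall c a b x, U x -> christoffel g c a b x = christoffel g c b a x.

Lemma nablaE k (T : components R k) a (I : k.-tuple 'I_4) x :
  nabla g T [tuple of a :: I] x =
  partial a (T I) x - act (G a x) (T^~ x) I.
Proof. by rewrite /nabla /= behead_tuple_cons. Qed.

Section Tensor.
Context {k : nat}.
Variable T : components R k.
Hypothesis smooth_T : forall I, smooth_on U (T I).

Lemma smooth_act b I : smooth_on U (fun y => act (G b y) (T^~ y) I).
Proof.
apply: smooth_on_sum => // m; apply: smooth_on_sum => // e.
by apply: smooth_onM => //; exact: smooth_christoffel.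
Qed.

Lemma partial_act a b I x : U x ->
  partial a (fun y => act (G b y) (T^~ y) I) x =
  act (fun e i => partial a (christoffel g e b i) x) (T^~ x) I +
  act (G b x) (fun J => partial a (T J) x) I.
Proof.
move=> Ux; rewrite partial_sum //; last first.
  move=> m; apply: smooth_on_sum => // e.
  by apply: smooth_onM => //; exact: smooth_christoffel.
rewrite -big_split /=; apply: eq_bigr => m _.
rewrite partial_sum //; last first.
  by move=> e; apply: smooth_onM => //; exact: smooth_christoffel.
rewrite -big_split /=; apply: eq_bigr => e _.
rewrite partialM; first last.
- exact: smooth_on_derivable (smooth_T _) Ux.
- exact: smooth_on_derivable (smooth_christoffel _ _ _) Ux.
by rewrite addrC [T _ x * _]mulrC.
Qed.

(** Antisymmetrizing in [a] and [b] leaves only the terms with a derivative of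
    the Christoffel symbols and those quadratic in them: the second partial
    derivative and the terms with one derivative of [T] are symmetric, and so
    is the last sum, the connection being torsion-free. *)
Lemma nabla_nablaE a b (I : k.-tuple 'I_4) x : U x ->
  nabla g (nabla g T) [tuple of a :: [tuple of b :: I]] x =
  partial a (partial b (T I)) x
  - act (fun e i => partial a (christoffel g e b i) x) (T^~ x) I
  - (act (G b x) (fun J => partial a (T J) x) I
     + act (G a x) (fun J => partial b (T J) x) I)
  + act (G a x) (act (G b x) (T^~ x)) I
  - \sum_(e < 4) christoffel g e a b x * nabla g T [tuple of e :: I] x.
Proof.
move=> Ux; rewrite nablaE.
have -> : nabla g T [tuple of b :: I] =
    (fun y => partial b (T I) y + - act (G b y) (T^~ y) I).
  by apply/funext => y; rewrite nablaE.
rewrite partialD; first last.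
- by apply: smooth_on_derivable Ux; apply: smooth_onN => //; apply: smooth_act.
- by apply: smooth_on_derivable Ux; apply: smooth_on_partial.
rewrite [partial a (fun y => - _) x](_ : _ =
   - partial a (fun y => act (G b y) (T^~ y) I) x); last first.
  by apply: deriveN; apply: smooth_on_derivable Ux; apply: smooth_act.
rewrite partial_act //.
have regroup (p d l1 l2 q s t : R) : t = s + (l2 - q) ->
    p - (d + l1) - t = p - d - (l1 + l2) + q - s by move=> ->; ring.
apply: regroup.
rewrite [LHS]/act big_ord_recl /=; congr (_ + _).
  by apply: eq_bigr => e _; rewrite subst_index_head.
rewrite -sumrB; apply: eq_bigr => m _.
rewrite -sumrB; apply: eq_bigr => e _.
by rewrite subst_index_behead nablaE mulrBr tnthS.
Qed.

(** The Ricci identity for covariant tensors of arbitrary rank. *)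
Lemma ricci_identity a b I x : U x ->
  nabla_antisym g T a b I x =
  - 2^-1 * act (fun e i => riemann_up g e i a b x) (T^~ x) I.
Proof.
move=> Ux; rewrite /nabla_antisym !nabla_nablaE //.
have regroup (p1 p2 d1 d2 l1 l2 q1 q2 s1 s2 r : R) :
    p1 = p2 -> s1 = s2 -> r = d1 - d2 - (q1 - q2) ->
    2^-1 * ((p1 - d1 - (l1 + l2) + q1 - s1) - (p2 - d2 - (l2 + l1) + q2 - s2)) =
    - 2^-1 * r by move=> -> -> ->; ring.
apply: regroup; first exact: partialC oU (smooth_T I) Ux.
  by apply: eq_bigr => e _; rewrite christoffelC.
rewrite act_commutator /act -!sumrB; apply: eq_bigr => m _.
rewrite -!sumrB; apply: eq_bigr => e _.
rewrite -!mulrBl; congr (_ * _); rewrite /riemann_up; congr (_ + _).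
rewrite -sumrN; apply: eq_bigr => f _; rewrite opprB.
by congr (_ - _); exact: mulrC.
Qed.

End Tensor.
End RicciIdentity.

(** * Symmetries of the curvature of the Levi-Civita connection *)

Section LeviCivita.
Context {R : realType}.
Variables (g : 'rV[R]_4 -> 'M[R]_4) (U : set 'rV[R]_4).
Hypothesis oU : open U.
Hypothesis smooth_g : forall i j, smooth_on U (fun x => g x i j).
Hypothesis sym_g : forall x, U x -> (g x)^T = g x.
Hypothesis unit_g : forall x, U x -> g x \in unitmx.

Lemma gdnC a b x : U x -> gdn g a b x = gdn g b a x.
Proof. by move=> Ux; rewrite /gdn -{1}(sym_g Ux) mxE. Qed.

Lemma smooth_gdn a b : smooth_on U (gdn g a b).
Proof. exact: smooth_g. Qed.

Lemma smooth_gup a b : smooth_on U (gup g a b).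
Proof. exact: smooth_on_invmx. Qed.

Lemma smooth_christoffel c a b : smooth_on U (christoffel g c a b).
Proof.
apply: smooth_onM => //; first exact: smooth_on_cst.
apply: smooth_on_sum => // d; apply: smooth_onM => //; first exact: smooth_gup.
by apply: smooth_onB => //; first apply: smooth_onD => //;
  apply: smooth_on_partial; exact: smooth_gdn.
Qed.

Lemma smooth_riemann_up a b c d : smooth_on U (riemann_up g a b c d).
Proof.
apply: smooth_onD => //.
  by apply: smooth_onB => //; apply: smooth_on_partial; exact: smooth_christoffel.
apply: smooth_on_sum => // e.
by apply: smooth_onB => //; apply: smooth_onM => //; exact: smooth_christoffel.
Qed.

Lemma smooth_riemann a b c d : smooth_on U (riemann g a b c d).
Proof.
apply: smooth_on_sum => // e; apply: smooth_onM => //; first exact: smooth_gdn.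
exact: smooth_riemann_up.
Qed.

Lemma smooth_ricci a b : smooth_on U (ricci g a b).
Proof. by apply: smooth_on_sum => // c; exact: smooth_riemann_up. Qed.

Lemma smooth_weyl a b c d : smooth_on U (weyl g a b c d).
Proof.
have gR i j k l : smooth_on U (fun x => gdn g i j x * ricci g k l x).
  by apply: smooth_onM => //; [exact: smooth_gdn | exact: smooth_ricci].
have gg i j k l : smooth_on U (fun x => gdn g i j x * gdn g k l x).
  by apply: smooth_onM => //; exact: smooth_gdn.
apply: smooth_onD => //.
  apply: smooth_onB => //; first exact: smooth_riemann.
  apply: smooth_onM => //; first exact: smooth_on_cst.
  by apply: smooth_onD => //; do 2?apply: smooth_onB => //; exact: gR.
apply: smooth_onM => //; last by apply: smooth_onB => //; exact: gg.
apply: smooth_onM => //; first exact: smooth_on_cst.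
do 2![apply: smooth_on_sum => // ?]; apply: smooth_onM => //.
  exact: smooth_gup.
exact: smooth_ricci.
Qed.

Lemma christoffelC c a b x : U x ->
  christoffel g c a b x = christoffel g c b a x.
Proof.
move=> Ux; rewrite /christoffel; congr (_ * _); apply: eq_bigr => d _.
rewrite [partial a (gdn g d b) x + _]addrC; congr (_ * (_ - _)).
by apply: (eq_partial_on d oU) Ux => y Uy; apply: gdnC.
Qed.

(** The Christoffel symbols of the first kind. *)
Lemma gdn_christoffel c a b x : U x ->
  \sum_(e < 4) gdn g c e x * christoffel g e a b x =
  2^-1 * (partial a (gdn g c b) x + partial b (gdn g c a) x
          - partial c (gdn g a b) x).
Proof.
move=> Ux; rewrite /christoffel.
under eq_bigr do rewrite mulrCA mulr_sumr.
rewrite -mulr_sumr exchange_big /=; congr (_ * _).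
under eq_bigr => d _.
  under eq_bigr do rewrite mulrA.
  rewrite -mulr_suml.
  have -> : \sum_(e < 4) gdn g c e x * gup g e d x = (c == d)%:R.
    transitivity ((g x *m invmx (g x)) c d); first by rewrite mxE.
    by rewrite mulmxV ?unit_g // mxE.
  over.
rewrite (bigD1 c) //= eqxx mul1r big1 ?addr0 // => d dc.
by rewrite eq_sym (negbTE dc) mul0r.
Qed.

(** The metric as a covariant tensor of rank 2. *)
Definition metric_tensor : components R 2 :=
  fun I => gdn g (tnth I 0) (tnth I 1).

(** The Levi-Civita connection is metric. *)
Lemma nabla_metric I x : U x -> nabla g metric_tensor I x = 0.
Proof.
move=> Ux; rewrite (tuple_eta I) nablaE.
move: (thead I) (behead_tuple I) => a J.
rewrite [X in _ - X](act2 _ (fun i j => gdn g i j x)) /=.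
set b := tnth J 0; set c := tnth J 1.
have Gr i j k : \sum_(e < 4) christoffel g e i j x * gdn g k e x =
    \sum_(e < 4) gdn g k e x * christoffel g e i j x.
  by apply: eq_bigr => e _; rewrite mulrC.
have Gl i j k : \sum_(e < 4) christoffel g e i j x * gdn g e k x =
    \sum_(e < 4) gdn g k e x * christoffel g e i j x.
  by apply: eq_bigr => e _; rewrite mulrC gdnC.
rewrite Gl Gr !gdn_christoffel //.
rewrite /metric_tensor -/b -/c.
have E i j k : partial i (gdn g j k) x = partial i (gdn g k j) x.
  by apply: (eq_partial_on i oU) Ux => y Uy; apply: gdnC.
by rewrite (E c b a) (E b c a) (E a c b); field.
Qed.

(** The Ricci identity for the metric, which is parallel. *)
Lemma riemann_antisym_l a b c d x : U x ->
  riemann g a b c d x = - riemann g b a c d x.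
Proof.
move=> Ux; have nn0 : nabla_antisym g metric_tensor c d [tuple a; b] x = 0.
  have n0 i (J : 3.-tuple 'I_4) :
      nabla g (nabla g metric_tensor) [tuple of i :: J] x = 0.
    rewrite nablaE (_ : partial i _ x = 0); last first.
      rewrite -[RHS](derive_cst (0 : R) x (delta_mx 0 i)).
      by apply: (eq_partial_on i oU) Ux => y Uy; apply: nabla_metric.
    rewrite /act big1 ?subr0 // => m _; rewrite big1 // => e _.
    by rewrite nabla_metric // mulr0.
  by rewrite /nabla_antisym !n0 subrr mulr0.
move: nn0; rewrite (ricci_identity oU smooth_christoffel christoffelC) //;
  last by move=> I; exact: smooth_gdn.
rewrite (act2 _ (fun i j => gdn g i j x)) /= => /eqP.
rewrite mulf_eq0 oppr_eq0 invr_eq0 (_ : 2 == 0 = false) /=; last first.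
  by rewrite pnatr_eq0.
rewrite addrC addr_eq0 => /eqP E; rewrite /riemann.
under eq_bigr do rewrite mulrC; rewrite E; congr (- _).
by apply: eq_bigr => e _; rewrite mulrC gdnC.
Qed.

Lemma riemann_up_antisym_r a b c d x :
  riemann_up g a b c d x = - riemann_up g a b d c x.
Proof.
rewrite /riemann_up opprD opprB -sumrN; congr (_ + _).
by apply: eq_bigr => e _; rewrite opprB.
Qed.

Lemma riemann_antisym_r a b c d x :
  riemann g a b c d x = - riemann g a b d c x.
Proof.
rewrite /riemann -sumrN; apply: eq_bigr => e _.
by rewrite riemann_up_antisym_r mulrN.
Qed.

(** The first Bianchi identity; it only uses the absence of torsion. *)
Lemma riemann_up_bianchi a b c d x : U x ->
  riemann_up g a b c d x + riemann_up g a c d b x + riemann_up g a d b c x = 0.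
Proof.
move=> Ux; rewrite /riemann_up.
have E i j k l :
    partial i (christoffel g j k l) x = partial i (christoffel g j l k) x.
  by apply: (eq_partial_on i oU) Ux => y Uy; apply: christoffelC.
set S1 := \sum_(e < 4) _; set S2 := \sum_(e < 4) _; set S3 := \sum_(e < 4) _.
have S0 : S1 + S2 + S3 = 0.
  rewrite -!big_split /=; apply: big1 => e _.
  rewrite (christoffelC e c d) // (christoffelC e b d) //.
  rewrite (christoffelC e c b) //.
  move: (christoffel g a c e x) (christoffel g a d e x) (christoffel g a b e x).
  move: (christoffel g e d c x) (christoffel g e d b x) (christoffel g e b c x).
  by move=> *; ring.
rewrite (E c a d b) (E d a c b) (E b a c d) -[RHS]S0.
move: (partial c (christoffel g a b d) x) (partial d (christoffel g a b c) x).
move: (partial b (christoffel g a d c) x) S1 S2 S3 {S0} => *.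
by ring.
Qed.

Lemma riemann_bianchi a b c d x : U x ->
  riemann g a b c d x + riemann g a c d b x + riemann g a d b c x = 0.
Proof.
move=> Ux; rewrite /riemann -!big_split /= big1 // => e _.
by rewrite -!mulrDr riemann_up_bianchi // mulr0.
Qed.

End LeviCivita.

(** * Three-dimensional cross products over a field *)

Lemma sum_ord3 (V : nmodType) (F : 'I_3 -> V) :
  \sum_(i < 3) F i = F 0 + F 1 + F 2.
Proof.
rewrite !big_ord_recl big_ord0 addr0 !addrA.
by do ?congr (_ + _); congr F; apply: val_inj.
Qed.

Lemma ord3P (P : 'I_3 -> Prop) : P 0 -> P 1 -> P 2 -> forall i, P i.
Proof.
move=> P0 P1 P2 [[|[|[|//]]] i3].
- by rewrite (_ : Ordinal i3 = 0) //; apply: val_inj.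
- by rewrite (_ : Ordinal i3 = 1) //; apply: val_inj.
- by rewrite (_ : Ordinal i3 = 2) //; apply: val_inj.
Qed.

Section CrossProduct.
Context {K : fieldType}.
Implicit Types (f h n v : 'cV[K]_3) (Q : 'M[K]_3).

(** The matrix of the cross product with [f]: [cross_mx f *m h] is [f x h].
    The additions on indices are modulo 3. *)
Definition cross_mx f : 'M[K]_3 :=
  \matrix_(i, j) if j == i + 1 then - f (i + 2) 0
                 else if j == i + 2 then f (i + 1) 0 else 0.

Lemma cross_mxE f :
  [/\ [/\ cross_mx f 0 0 = 0, cross_mx f 0 1 = - f 2 0 & cross_mx f 0 2 = f 1 0],
  [/\ cross_mx f 1 0 = f 2 0, cross_mx f 1 1 = 0 & cross_mx f 1 2 = - f 0 0] &
  [/\ cross_mx f 2 0 = - f 1 0, cross_mx f 2 1 = f 0 0 & cross_mx f 2 2 = 0]].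
Proof.
split; split; rewrite mxE //=;
  by congr (_ (f _ _)) || congr (f _ _); apply: val_inj.
Qed.

Let crE f := let: And3 (And3 a b c) (And3 d e g) (And3 h i j) := cross_mxE f in
  (a, b, c, d, e, g, h, i, j).

Lemma cross_mxC f h : cross_mx f *m h = - (cross_mx h *m f).
Proof.
apply/matrixP => i j; rewrite (ord1 j) !mxE !sum_ord3.
by move: i; apply: ord3P; rewrite !crE; ring.
Qed.

Lemma tr_cross_mx f : (cross_mx f)^T = - cross_mx f.
Proof.
apply/matrixP => i j; rewrite [LHS]mxE [RHS]mxE.
by move: i j; do 2!apply: ord3P; rewrite !crE ?oppr0 ?opprK.
Qed.

(** The cross product is the bracket of so(3). *)
Lemma cross_mx_cross f h :
  cross_mx (cross_mx f *m h) = cross_mx f *m cross_mx h - cross_mx h *m cross_mx f.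
Proof.
apply/matrixP => i j; rewrite [RHS]mxE [X in _ + X]mxE.
by move: i j; do 2!apply: ord3P; rewrite !crE !mxE !sum_ord3 !crE; ring.
Qed.

(** The derivative at the identity of [M^T (Mf x) M = det M (f x)], for a
    symmetric and trace-free direction [Q]. *)
Lemma cross_mx_mulmx Q f : Q^T = Q -> \tr Q = 0 ->
  cross_mx (Q *m f) = - (cross_mx f *m Q + Q *m cross_mx f).
Proof.
move=> symQ; rewrite /mxtrace sum_ord3 => /eqP.
rewrite addr_eq0 => /eqP trQ.
have E i j : Q i j = Q j i by rewrite -{1}symQ mxE.
have Q22 : Q 2 2 = - (Q 0 0 + Q 1 1) by rewrite trQ opprK.
apply/matrixP => i j; rewrite [RHS]mxE [X in - X]mxE.
by move: i j; do 2!apply: ord3P; rewrite !crE !mxE !sum_ord3 !crE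
  ?(E 1 0) ?(E 2 0) ?(E 2 1) ?Q22; ring.
Qed.

(** If [n x v = 0] then [n] and [v] are parallel. *)
Lemma cross_mx_ker n v a i : cross_mx n *m v = 0 -> n a 0 * v i 0 = v a 0 * n i 0.
Proof.
move=> /matrixP nv.
have := (nv 0 0, nv 1 0, nv 2 0); rewrite !mxE !sum_ord3 !crE => -[[n0 n1] n2].
apply/eqP; rewrite -subr_eq0; apply/eqP; move: a i.
by do 2!apply: ord3P; (ring || (rewrite -n0; ring) || (rewrite -n1; ring) ||
 (rewrite -n2; ring) || (rewrite -oppr0 -n0; ring) || (rewrite -oppr0 -n1; ring)
  || (rewrite -oppr0 -n2; ring)).
Qed.

Hypotheses (K2 : 2 != 0 :> K) (K3 : 3 != 0 :> K).

(** The stabilizer in so(3) of a nonzero symmetric trace-free matrix is at most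
    a line. *)
Lemma commuting_cross_mx_parallel Q f h : Q^T = Q -> \tr Q = 0 -> Q != 0 ->
  cross_mx f *m Q = Q *m cross_mx f -> cross_mx h *m Q = Q *m cross_mx h ->
  cross_mx f *m h = 0.
Proof.
move=> symQ trQ Q0 fQ hQ; set n := cross_mx f *m h.
(* Qf x h equals -2 Qn by the trace identity, and Qn by commutation. *)
have Qn : Q *m n = 0.
  have E1 : cross_mx (Q *m f) *m h = - (Q *m n) *+ 2.
    by rewrite cross_mx_mulmx // fQ mulNmx mulmxDl -mulmxA -/n mulNrn mulr2n.
  have E2 : cross_mx (Q *m f) *m h = Q *m n.
    by rewrite cross_mxC mulmxA hQ -mulmxA /n [cross_mx f *m h]cross_mxC mulmxN.
  have : (Q *m n) *+ 3 = 0 by rewrite mulrS -{1}E2 E1 mulNrn addNr.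
  by move/eqP; rewrite -scaler_nat scaler_eq0 (negbTE K3) => /eqP.
have nQ : cross_mx n *m Q = 0.
  have nQc : cross_mx n *m Q = Q *m cross_mx n.
    by rewrite /n cross_mx_cross mulmxBl mulmxBr -!mulmxA hQ fQ !mulmxA fQ hQ.
  have : (cross_mx n *m Q) *+ 2 = 0.
    apply/eqP; rewrite -oppr_eq0 mulr2n {2}nQc -cross_mx_mulmx // Qn.
    by apply/eqP/matrixP => i j; rewrite !mxE oppr0 !if_same.
  by move/eqP; rewrite -scaler_nat scaler_eq0 (negbTE K2) => /eqP.
apply/eqP/negPn/negP => n0.
have En : n = cross_mx f *m h by [].
clearbody n.
have [a na] : exists a, n a 0 != 0.
  apply/existsP; apply: contraNT n0; rewrite negb_exists => /forallP nz.
  apply/eqP/matrixP => i j; rewrite ord1 [RHS]mxE; apply/eqP.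
  by rewrite -[_ == _]negbK nz.
(* The columns of Q are multiples of n and Q is symmetric, so Q is a multiple
   of n n^T. *)
have QE i j : n a 0 ^+ 2 * Q i j = Q a a * (n i 0 * n j 0).
  have colQ k l : n a 0 * Q k l = Q a l * n k 0.
    have := @cross_mx_ker n (col l Q) a k; rewrite !mxE; apply.
    by rewrite colE mulmxA nQ mul0mx.
  have Es : Q a j = Q j a by rewrite -{1}symQ mxE.
  by rewrite expr2 -mulrA colQ mulrA Es colQ; ring.
have Qaa : Q a a != 0.
  apply: contraNneq Q0 => Qaa; apply/eqP/matrixP => i j; rewrite [RHS]mxE.
  have := QE i j; rewrite Qaa mul0r => /eqP.
  by rewrite mulf_eq0 expf_eq0 (negbTE na) => /eqP.
have Qnn : n a 0 ^+ 2 *: Q = Q a a *: (n *m n^T).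
  by apply/matrixP => i j; rewrite !mxE QE big_ord1 !mxE.
have kern k : cross_mx k *m Q = Q *m cross_mx k -> cross_mx k *m n = 0.
  move=> kQ; set m := cross_mx k *m n.
  have Z : m *m n^T + n *m m^T = 0.
    apply: (scalerI Qaa); rewrite scaler0 scalerDr.
    have -> : m^T = - (n^T *m cross_mx k) by rewrite trmx_mul tr_cross_mx mulmxN.
    transitivity (cross_mx k *m (Q a a *: (n *m n^T)) -
                  Q a a *: (n *m n^T) *m cross_mx k).
      by rewrite -scalemxAr -scalemxAl mulmxN scalerN !mulmxA.
    by rewrite -Qnn -scalemxAl -scalemxAr kQ subrr.
  have mn i : m i 0 * n a 0 + n i 0 * m a 0 = 0.
    by move/matrixP/(_ i a): Z; rewrite !mxE !big_ord1 !mxE.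
  have ma : m a 0 = 0.
    have /eqP := mn a; rewrite [n a 0 * _]mulrC -mulr2n -mulr_natl.
    by rewrite !mulf_eq0 (negbTE K2) (negbTE na) orbF => /eqP.
  apply/matrixP => i j; rewrite ord1 [RHS]mxE.
  by have /eqP := mn i; rewrite ma mulr0 addr0 mulf_eq0 (negbTE na) orbF => /eqP.
(* As n x h = - (h x n) = 0, h is parallel to n; then n = f x h is a multiple
   of f x n = 0. *)
have hn i : n a 0 * h i 0 = h a 0 * n i 0.
  by apply: cross_mx_ker; rewrite cross_mxC kern // oppr0.
have : n a 0 *: n = 0.
  have -> : n a 0 *: n = cross_mx f *m (n a 0 *: h) by rewrite -scalemxAr -En.
  have -> : n a 0 *: h = h a 0 *: n.
    by apply/matrixP => i j; rewrite ord1 !mxE hn.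
  by rewrite -scalemxAr kern // scaler0.
by move/eqP; rewrite scaler_eq0 (negbTE na) (negbTE n0).
Qed.

End CrossProduct.

(** * Weyl tensors in an orthonormal frame *)

Lemma ord4P (P : 'I_4 -> Prop) : P 0 -> P 1 -> P 2 -> P 3 -> forall i, P i.
Proof.
move=> P0 P1 P2 P3 [[|[|[|[|//]]]] i4].
- by rewrite (_ : Ordinal i4 = 0) //; apply: val_inj.
- by rewrite (_ : Ordinal i4 = 1) //; apply: val_inj.
- by rewrite (_ : Ordinal i4 = 2) //; apply: val_inj.
- by rewrite (_ : Ordinal i4 = 3) //; apply: val_inj.
Qed.

(** Column vectors and symmetric trace-free matrices from their independent
    entries. *)
Definition col3 (K : nzRingType) (x y z : K) : 'cV[K]_3 :=
  \col_i (if i == 0 then x else if i == 1 then y else z).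

Definition symm3 (K : nzRingType) (a b c d e : K) : 'M[K]_3 :=
  \matrix_(i, j) (if i == 0 then (if j == 0 then a else if j == 1 then b else c)
    else if i == 1 then (if j == 0 then b else if j == 1 then d else e)
    else (if j == 0 then c else if j == 1 then e else - a - d)).

Section MinkowskiFrame.
Context {R : rcfType}.

(** The algebraic symmetries of a curvature tensor. *)
Record curvature_like (C : 'I_4 -> 'I_4 -> 'I_4 -> 'I_4 -> R) : Prop := {
  curv_antisym_l : forall a b c d, C a b c d = - C b a c d;
  curv_antisym_r : forall a b c d, C a b c d = - C a b d c;
  curv_bianchi : forall a b c d, C a b c d + C a c d b + C a d b c = 0 }.

Lemma curv_pair C : curvature_like C -> forall a b c d, C a b c d = C c d a b.
Proof.
move=> [al ar bi] a b c d.
have := (bi a b c d, bi b c d a, bi c d a b, bi d a b c).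
rewrite (al b d a) (al b a c) (al c a b) (al c b d) (ar a c b) (al d a b).
by rewrite (al d c a) (ar b c d) (ar d b c) => -[[[]]]; lra.
Qed.

Section SelfDual.
(* The four indices of an orthonormal frame, o being the timelike one, kept
   abstract so that rewriting with concrete components is purely syntactic. *)
Variables (T : Type) (o x y z : T).
Hypothesis cover :
  forall P : T -> Prop, P o -> P x -> P y -> P z -> forall t, P t.
Implicit Types (C : T -> T -> T -> T -> R) (F H : T -> T -> R).

Definition sum4 (f : T -> R) := f o + f x + f y + f z.

(** The action of the endomorphism [F e i = F^e_i] on a covariant tensor of
    rank 4: the same as [act], in terms of the four indices. *)
Definition derivation F C a b c d := sum4 (fun e =>
  F e a * C e b c d + F e b * C a e c d + F e c * C a b e d + F e d * C a b c e).

(** Endomorphisms that are skew-adjoint for diag(-1,1,1,1): boosts are symmetric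
    and rotations antisymmetric. *)
Record lorentz_algebra F : Prop := {
  lor_oo : F o o = 0; lor_xx : F x x = 0; lor_yy : F y y = 0; lor_zz : F z z = 0;
  lor_ox : F o x = F x o; lor_oy : F o y = F y o; lor_oz : F o z = F z o;
  lor_xy : F x y = - F y x; lor_yz : F y z = - F z y; lor_zx : F z x = - F x z }.

(** The isomorphism of the Lorentz algebra with so(3,C): the boost part plus [i]
    times the rotation part. *)
Definition cvec F : 'cV[R[i]]_3 :=
  col3 (F x o +i* F z y)%C (F y o +i* F x z)%C (F z o +i* F y x)%C.

(** The complex symmetric trace-free matrix [E + iB] of a Weyl tensor [C], with
    [E_ij = C_oioj] and [B_ij = C_oikl] for [j], [k], [l] a cyclic permutation
    of [x], [y], [z]. *)
Definition cmat C : 'M[R[i]]_3 :=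
  symm3 (C o x o x +i* C o x y z)%C (C o x o y +i* C o x z x)%C
    (C o x o z +i* C o x x y)%C (C o y o y +i* C o y z x)%C
    (C o y o z +i* C o y x y)%C.

Section Table.
Variable C : T -> T -> T -> T -> R.
Hypothesis al : forall a b c d, C a b c d = - C b a c d.
Hypothesis ar : forall a b c d, C a b c d = - C a b d c.
Hypothesis pr : forall a b c d, C a b c d = C c d a b.
Hypothesis bi : forall a b c d, C a b c d + C a c d b + C a d b c = 0.
Hypothesis tr : forall b d, - C o b o d + C x b x d + C y b y d + C z b z d = 0.

Lemma curv_diag_l a c d : C a a c d = 0.
Proof. by have := al a a c d; lra. Qed.
Lemma curv_diag_r a c d : C c d a a = 0.
Proof. by have := ar c d a a; lra. Qed.

(* Bivector indices are brought to the forms ox, oy, oz, yz, zx, xy. *)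
Let dg := (curv_diag_l, curv_diag_r).
Let order := (dg, al x o, al y o, al z o, al z y, al x z, al y x,
                 (fun a b => ar a b x o), (fun a b => ar a b y o),
  (fun a b => ar a b z o), (fun a b => ar a b z y),
  (fun a b => ar a b x z), (fun a b => ar a b y x)).
Let pairs := (pr o y o x, pr o z o x, pr o z o y,
  pr y z o x, pr y z o y, pr y z o z, pr z x o x, pr z x o y, pr z x o z,
  pr x y o x, pr x y o y, pr x y o z, pr z x y z, pr x y y z, pr x y z x).

(** The components of a Weyl tensor in terms of the ten entries of [E] and [B]:
    [E] and [B] are symmetric and trace-free, and the purely spatial components
    are given by [- E]. *)
Lemma weyl_zz : C o z o z = - C o x o x - C o y o y.
Proof. by have := tr o o; rewrite ?order ?pairs; lra. Qed.
Lemma weyl_yx : C o y y z = C o x z x.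
Proof. by have := tr o z; rewrite ?order ?pairs; lra. Qed.
Lemma weyl_zx : C o z y z = C o x x y.
Proof. by have := tr o y; rewrite ?order ?pairs; lra. Qed.
Lemma weyl_zy : C o z z x = C o y x y.
Proof. by have := tr o x; rewrite ?order ?pairs; lra. Qed.
Lemma weyl_Bzz : C o z x y = - C o x y z - C o y z x.
Proof. by have := bi o x y z; rewrite ?order; lra. Qed.
Let tx := tr x x. Let ty := tr y y. Let tz := tr z z.
Lemma weyl_yzyz : C y z y z = - C o x o x.
Proof. by move: tx ty tz; rewrite ?order ?pairs weyl_zz; lra. Qed.
Lemma weyl_zxzx : C z x z x = - C o y o y.
Proof. by move: tx ty tz; rewrite ?order ?pairs weyl_zz; lra. Qed.
Lemma weyl_xyxy : C x y x y = C o x o x + C o y o y.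
Proof. by move: tx ty tz; rewrite ?order ?pairs weyl_zz; lra. Qed.
Lemma weyl_yzzx : C y z z x = - C o x o y.
Proof. by have := tr x y; rewrite ?order ?pairs; lra. Qed.
Lemma weyl_yzxy : C y z x y = - C o x o z.
Proof. by have := tr x z; rewrite ?order ?pairs; lra. Qed.
Lemma weyl_zxxy : C z x x y = - C o y o z.
Proof. by have := tr y z; rewrite ?order ?pairs; lra. Qed.

Let table := (order, pairs, (weyl_zz, weyl_yx, weyl_zx, weyl_zy, weyl_Bzz,
  weyl_yzyz, weyl_zxzx, weyl_xyxy, weyl_yzzx, weyl_yzxy, weyl_zxxy)).

(** If [F] annihilates [C] then the cross product with [cvec F] commutes with
    [cmat C]. *)
Lemma cross_mx_cmatC F : lorentz_algebra F ->
  (forall a b c d, derivation F C a b c d = 0) ->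
  cross_mx (cvec F) *m cmat C = cmat C *m cross_mx (cvec F).
Proof.
move=> [oo xx yy zz ox oy oz xy yz zx] dF.
have lor := (oo, xx, yy, zz, ox, oy, oz, xy, yz, zx).
have [[s00 s01 s02] [s10 s11 s12] [s20 s21 s22]] := cross_mxE (cvec F).
have sk := (s00, s01, s02, s10, s11, s12, s20, s21, s22).
have D a b c d := dF a b c d; rewrite /derivation /sum4 in D.
apply/matrixP => i j; rewrite [LHS]mxE [RHS]mxE !sum_ord3.
move: i j; do 2!apply: ord3P; rewrite !sk !mxE /=; simpc; congr (_ +i* _)%C.
(* In each entry, the real part is a component of F.C with index oi,kl and the
   imaginary part one with index oi,oj. *)
- have := D o x y z; rewrite ?lor ?table; lra.
- have := D o x o x; rewrite ?lor ?table; lra.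
- have := D o x z x; rewrite ?lor ?table; lra.
- have := D o x o y; rewrite ?lor ?table; lra.
- have := D o x x y; rewrite ?lor ?table; lra.
- have := D o x o z; rewrite ?lor ?table; lra.
- have := D o y y z; rewrite ?lor ?table; lra.
- have := D o y o x; rewrite ?lor ?table; lra.
- have := D o y z x; rewrite ?lor ?table; lra.
- have := D o y o y; rewrite ?lor ?table; lra.
- have := D o y x y; rewrite ?lor ?table; lra.
- have := D o y o z; rewrite ?lor ?table; lra.
- have := D o z y z; rewrite ?lor ?table; lra.
- have := D o z o x; rewrite ?lor ?table; lra.
- have := D o z z x; rewrite ?lor ?table; lra.
- have := D o z o y; rewrite ?lor ?table; lra.
- have := D o z x y; rewrite ?lor ?table; lra.
- have := D o z o z; rewrite ?lor ?table; lra.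
Qed.

Lemma cmat_eq0 : cmat C = 0 -> forall a b c d, C a b c d = 0.
Proof.
move=> /matrixP C0.
have := (C0 0 0, C0 0 1, C0 0 2, C0 1 1, C0 1 2); rewrite !mxE /=.
move=> [[[[[exx bxx] [exy bxy]] [exz bxz]] [eyy byy]] [eyz byz]].
have vanish := (exx, bxx, exy, bxy, exz, bxz, eyy, byy, eyz, byz).
by do 4!apply: cover; rewrite ?table ?vanish ?(oppr0, addr0, subr0).
Qed.

End Table.

Lemma tr_cmat C : (cmat C)^T = cmat C.
Proof.
by apply/matrixP => i j; rewrite !mxE; move: i j; do 2!apply: ord3P.
Qed.

Lemma trace_cmat C : \tr (cmat C) = 0.
Proof. by rewrite /mxtrace sum_ord3 !mxE /=; ring. Qed.

(** Elements of the Lorentz algebra with parallel complex vectors commute. *)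
Lemma cvec_parallel F H : lorentz_algebra F -> lorentz_algebra H ->
  cross_mx (cvec F) *m cvec H = 0 -> forall a c,
  sum4 (fun e => F a e * H e c) = sum4 (fun e => H a e * F e c).
Proof.
move=> [oo xx yy zz ox oy oz xy yz zx].
move=> [oo' xx' yy' zz' ox' oy' oz' xy' yz' zx'].
have lor := (oo, xx, yy, zz, ox, oy, oz, xy, yz, zx).
have lor' := (oo', xx', yy', zz', ox', oy', oz', xy', yz', zx').
have [[s00 s01 s02] [s10 s11 s12] [s20 s21 s22]] := cross_mxE (cvec F).
have sk := (s00, s01, s02, s10, s11, s12, s20, s21, s22).
move=> /matrixP fh; have := (fh 0 0, fh 1 0, fh 2 0).
rewrite !mxE !sum_ord3 !sk !mxE /=; simpc.
move=> -[[[r0 i0] [r1 i1]] [r2 i2]].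
by do 2!apply: cover; rewrite /sum4 ?lor ?lor'; lra.
Qed.

End SelfDual.
End MinkowskiFrame.

(** * Change of frame *)

Section Frames.
Context {R : comUnitRingType}.
Implicit Types (P Q : 'M[R]_4) (C : 'I_4 -> 'I_4 -> 'I_4 -> 'I_4 -> R).

Lemma sum_mulC (I J : finType) (p : I -> R) (q : J -> R) (f : I -> J -> R) :
  \sum_i p i * (\sum_j q j * f i j) = \sum_j q j * (\sum_i p i * f i j).
Proof.
under eq_bigr do rewrite mulr_sumr.
under [RHS]eq_bigr do rewrite mulr_sumr.
by rewrite exchange_big /=; do 2!apply: eq_bigr => ? _; rewrite mulrCA.
Qed.

Lemma sum_mulmx P Q (f : 'I_4 -> R) a :
  \sum_i P a i * (\sum_j Q i j * f j) = \sum_j (P *m Q) a j * f j.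
Proof.
under eq_bigr do rewrite mulr_sumr.
rewrite exchange_big /=; apply: eq_bigr => j _; rewrite mxE mulr_suml.
by apply: eq_bigr => i _; rewrite mulrA.
Qed.

Lemma sum_mul1mx (f : 'I_4 -> R) a : \sum_i (1%:M : 'M[R]_4) a i * f i = f a.
Proof.
rewrite (bigD1 a) //= mxE eqxx mul1r big1 ?addr0 // => i ia.
by rewrite mxE eq_sym (negbTE ia) mul0r.
Qed.

(** The change of basis [P] applied to one slot only of a covariant tensor of
    rank 4. *)
Definition slot1 P C a b c d := \sum_i P a i * C i b c d.
Definition slot2 P C a b c d := \sum_i P b i * C a i c d.
Definition slot3 P C a b c d := \sum_i P c i * C a b i d.
Definition slot4 P C a b c d := \sum_i P d i * C a b c i.

Lemma slot21 P Q C : slot2 P (slot1 Q C) = slot1 Q (slot2 P C).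
Proof. by do 4!apply/funext => ?; exact: sum_mulC. Qed.
Lemma slot31 P Q C : slot3 P (slot1 Q C) = slot1 Q (slot3 P C).
Proof. by do 4!apply/funext => ?; exact: sum_mulC. Qed.
Lemma slot41 P Q C : slot4 P (slot1 Q C) = slot1 Q (slot4 P C).
Proof. by do 4!apply/funext => ?; exact: sum_mulC. Qed.
Lemma slot32 P Q C : slot3 P (slot2 Q C) = slot2 Q (slot3 P C).
Proof. by do 4!apply/funext => ?; exact: sum_mulC. Qed.
Lemma slot42 P Q C : slot4 P (slot2 Q C) = slot2 Q (slot4 P C).
Proof. by do 4!apply/funext => ?; exact: sum_mulC. Qed.
Lemma slot43 P Q C : slot4 P (slot3 Q C) = slot3 Q (slot4 P C).
Proof. by do 4!apply/funext => ?; exact: sum_mulC. Qed.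

(** Rewriting rules that sort changes of basis by slot. *)
Definition slot_sort := (slot21, slot31, slot41, slot32, slot42, slot43).

Lemma slot1M P Q C : slot1 P (slot1 Q C) = slot1 (P *m Q) C.
Proof.
by do 4!apply/funext => ?; exact: (sum_mulmx P Q (fun j => C j _ _ _)).
Qed.
Lemma slot2M P Q C : slot2 P (slot2 Q C) = slot2 (P *m Q) C.
Proof.
by do 4!apply/funext => ?; exact: (sum_mulmx P Q (fun j => C _ j _ _)).
Qed.
Lemma slot3M P Q C : slot3 P (slot3 Q C) = slot3 (P *m Q) C.
Proof.
by do 4!apply/funext => ?; exact: (sum_mulmx P Q (fun j => C _ _ j _)).
Qed.
Lemma slot4M P Q C : slot4 P (slot4 Q C) = slot4 (P *m Q) C.
Proof.
by do 4!apply/funext => ?; exact: (sum_mulmx P Q (fun j => C _ _ _ j)).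
Qed.

Lemma slot_1 C :
  [/\ slot1 1%:M C = C, slot2 1%:M C = C, slot3 1%:M C = C & slot4 1%:M C = C].
Proof.
split; do 4!apply/funext => ?.
- exact: (sum_mul1mx (fun j => C j _ _ _)).
- exact: (sum_mul1mx (fun j => C _ j _ _)).
- exact: (sum_mul1mx (fun j => C _ _ j _)).
- exact: (sum_mul1mx (fun j => C _ _ _ j)).
Qed.

(** Components of the covariant tensor [C] in the basis formed by the rows
    of [P]. *)
Definition frame P C := slot1 P (slot2 P (slot3 P (slot4 P C))).

Lemma frameK P C : P \in unitmx -> frame (invmx P) (frame P C) = C.
Proof.
move=> uP; rewrite /frame !slot_sort.
rewrite slot1M slot2M slot3M slot4M mulVmx //.
by have [e1 e2 e3 e4] := slot_1 C; rewrite e4 e3 e2 e1.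
Qed.

Lemma frame_add P C D a b c d :
  frame P (fun i j k l => C i j k l + D i j k l) a b c d =
  frame P C a b c d + frame P D a b c d.
Proof.
rewrite /frame /slot1 /slot2 /slot3 /slot4.
do 4!(rewrite -big_split /=; apply: eq_bigr => ? _; rewrite -mulrDr;
      congr (_ * _)).
Qed.

Lemma frame0 P a b c d : frame P (fun _ _ _ _ => 0) a b c d = 0.
Proof.
rewrite /frame /slot1 /slot2 /slot3 /slot4.
do 3!(apply: big1 => ? _; rewrite [X in _ * X](_ : _ = 0) ?mulr0 //).
by apply: big1 => ? _; rewrite mulr0.
Qed.

Lemma frame_opp P C a b c d :
  frame P (fun i j k l => - C i j k l) a b c d = - frame P C a b c d.
Proof.
apply/eqP; rewrite -addr_eq0 -frame_add -[X in _ == X](frame0 P a b c d).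
apply/eqP; congr (frame P _ a b c d).
by do 4!apply/funext => ?; rewrite addNr.
Qed.

Lemma frame_swap_l P C a b c d :
  frame P (fun i j k l => C j i k l) a b c d = frame P C b a c d.
Proof.
transitivity (slot2 P (slot1 P (slot3 P (slot4 P C))) b a c d); first by [].
by rewrite /frame !slot_sort.
Qed.

Lemma frame_swap_r P C a b c d :
  frame P (fun i j k l => C i j l k) a b c d = frame P C a b d c.
Proof.
transitivity (slot1 P (slot2 P (slot4 P (slot3 P C))) a b d c); first by [].
by rewrite /frame !slot_sort.
Qed.

Lemma frame_cycle P C a b c d :
  frame P (fun i j k l => C i k l j) a b c d = frame P C a c d b.
Proof.
transitivity (slot1 P (slot4 P (slot2 P (slot3 P C))) a c d b); first by [].
by rewrite /frame !slot_sort.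
Qed.

(** Equivariance of the insertion of an endomorphism into one slot. *)
Lemma frame_slot A B P C : A *m P = P *m B ->
  [/\ slot1 A (frame P C) = frame P (slot1 B C),
      slot2 A (frame P C) = frame P (slot2 B C),
      slot3 A (frame P C) = frame P (slot3 B C) &
      slot4 A (frame P C) = frame P (slot4 B C)].
Proof.
move=> AP; rewrite /frame !slot_sort.
by rewrite !slot1M !slot2M !slot3M !slot4M AP.
Qed.

(** The contraction of the first and third slots by [D] in the new frame is the
    new frame expression of the contraction by [P^T D P]. *)
Lemma frame_trace (D : 'M[R]_4) P C b d :
  \sum_a \sum_c D a c * frame P C a b c d =
  \sum_j P b j * \sum_l P d l * \sum_i \sum_k (P^T *m D *m P) i k * C i j k l.
Proof.
transitivity (\sum_a \sum_c D a c *
                slot1 P (slot3 P (slot2 P (slot4 P C))) a b c d).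
  by do 2!apply: eq_bigr => ? _; rewrite /frame slot32.
set X := slot2 P (slot4 P C).
transitivity (\sum_i \sum_k (P^T *m D *m P) i k * X i b k d).
  under eq_bigr => a _.
    under eq_bigr => c _.
      rewrite /slot1 /slot3 mulr_sumr.
      under eq_bigr do rewrite mulr_sumr mulr_sumr.
      over.
    over.
  rewrite /=.
  transitivity (\sum_i \sum_k \sum_a \sum_c
                  D a c * (P a i * (P c k * X i b k d))).
    under eq_bigr do rewrite exchange_big /=.
    rewrite exchange_big /=; apply: eq_bigr => i _.
    under eq_bigr do rewrite exchange_big /=.
    by rewrite exchange_big.
  do 2!apply: eq_bigr => ? _; rewrite mxE mulr_suml exchange_big /=.
  apply: eq_bigr => c _; rewrite mxE !mulr_suml; apply: eq_bigr => a _.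
  by rewrite mxE; ring.
rewrite pair_big /=.
under eq_bigr do rewrite /X /slot2.
rewrite sum_mulC; apply: eq_bigr => j _; congr (_ * _).
under eq_bigr do rewrite /slot4.
by rewrite sum_mulC; apply: eq_bigr => l _; rewrite pair_big.
Qed.

End Frames.

(** * The stabilizer of a Weyl tensor *)

Section Stabilizer.
Context {R : realType}.
Implicit Types (F G H P : 'M[R]_4).
(* Qualified, to denote the matrix rather than the integral inequality. *)
Local Notation eta := (Defs.minkowski R).

Lemma lorentz_algebra_mx F : (eta *m F)^T = - (eta *m F) ->
  lorentz_algebra 0 1 2 3 (fun a b => F a b).
Proof.
move=> /matrixP antiF.
have E a b : eta b b * F b a = - (eta a a * F a b).
  have etaF i j : (eta *m F) i j = eta i i * F i j.
    rewrite mxE (bigD1 i) //= big1 ?addr0 // => k ki.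
    by rewrite mxE eq_sym (negbTE ki) mul0r.
  by rewrite -!etaF; have := antiF a b; rewrite mxE [in RHS]mxE.
have etaE a : eta a a = if a == 0 then -1 else 1 by rewrite mxE eqxx.
split.
- by have := E 0 0; rewrite !etaE /=; lra.
- by have := E 1 1; rewrite !etaE /=; lra.
- by have := E 2 2; rewrite !etaE /=; lra.
- by have := E 3 3; rewrite !etaE /=; lra.
- by have := E 0 1; rewrite !etaE /=; lra.
- by have := E 0 2; rewrite !etaE /=; lra.
- by have := E 0 3; rewrite !etaE /=; lra.
- by have := E 1 2; rewrite !etaE /=; lra.
- by have := E 2 3; rewrite !etaE /=; lra.
- by have := E 3 1; rewrite !etaE /=; lra.
Qed.

Lemma minkowski_stabilizer_commute (C : 'I_4 -> 'I_4 -> 'I_4 -> 'I_4 -> R) F H :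
  curvature_like C ->
  (forall b d, \sum_(a < 4) \sum_(c < 4) eta a c * C a b c d = 0) ->
  (exists a b c d, C a b c d <> 0) ->
  (eta *m F)^T = - (eta *m F) ->
  (eta *m H)^T = - (eta *m H) ->
  (forall a b c d, derivation 0 1 2 3 (fun i j => F i j) C a b c d = 0) ->
  (forall a b c d, derivation 0 1 2 3 (fun i j => H i j) C a b c d = 0) ->
  F *m H = H *m F.
Proof.
move=> cC trC [a0 [b0 [c0 [d0 C0]]]] lF lH dF dH.
have [al ar bi] := cC; have pr := curv_pair cC.
have tr b d : - C 0 b 0 d + C 1 b 1 d + C 2 b 2 d + C 3 b 3 d = 0.
  by rewrite -(trC b d) !sum_ord4 !mxE /=; ring.
have K2 : 2 != 0 :> R[i] by rewrite pnatr_eq0.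
have K3 : 3 != 0 :> R[i] by rewrite pnatr_eq0.
have lF' := lorentz_algebra_mx lF; have lH' := lorentz_algebra_mx lH.
have Q0 : cmat 0 1 2 3 C != 0.
  apply/eqP => Q0; apply: C0.
  exact: (cmat_eq0 ord4P al ar pr bi tr Q0).
have par := commuting_cross_mx_parallel K2 K3 (tr_cmat _ _ _ _ C)
  (trace_cmat _ _ _ _ C) Q0 (cross_mx_cmatC al ar pr bi tr lF' dF)
  (cross_mx_cmatC al ar pr bi tr lH' dH).
apply/matrixP => a c; rewrite !mxE !sum_ord4.
exact: (cvec_parallel ord4P lF' lH' par).
Qed.

Lemma derivation_slots F C :
  derivation 0 1 2 3 (fun i j => F i j) C =
  (fun a b c d => slot1 F^T C a b c d + slot2 F^T C a b c d +
                  slot3 F^T C a b c d + slot4 F^T C a b c d).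
Proof.
do 4!apply/funext => ?; rewrite /derivation /slot1 /slot2 /slot3 /slot4.
by rewrite /sum4 !sum_ord4 !mxE; ring.
Qed.

Lemma minkowskiK : eta *m eta = 1%:M.
Proof.
apply/matrixP => i j; rewrite !mxE sum_ord4 !mxE.
by move: i j; do 2!apply: ord4P; rewrite /=; ring.
Qed.

Lemma lorentzian_unit G : lorentzian G -> G \in unitmx.
Proof.
move=> [_ [P _ lorP]].
have : (P *m G *m P^T) *m (P *m G *m P^T) = 1%:M.
  by case: lorP => ->; rewrite ?mulNmx ?mulmxN ?opprK minkowskiK.
by move=> /mulmx1_unit[]; rewrite !unitmx_mul => /andP[/andP[]].
Qed.

(** In the Lorentz algebra of [G], the elements that annihilate a given nonzero
    Weyl tensor commute.  The proof passes to an orthonormal frame. *)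
Lemma stabilizer_commute (C : 'I_4 -> 'I_4 -> 'I_4 -> 'I_4 -> R) G F H :
  lorentzian G -> curvature_like C ->
  (forall b d, \sum_(a < 4) \sum_(c < 4) invmx G a c * C a b c d = 0) ->
  (exists a b c d, C a b c d <> 0) ->
  (G *m F)^T = - (G *m F) -> (G *m H)^T = - (G *m H) ->
  (forall a b c d, derivation 0 1 2 3 (fun i j => F i j) C a b c d = 0) ->
  (forall a b c d, derivation 0 1 2 3 (fun i j => H i j) C a b c d = 0) ->
  F *m H = H *m F.
Proof.
move=> lorG; have [symG [P uP lorP]] := lorG; move=> cC trC C0 aF aH dF dH.
have [s [s0 ss GP]] : exists s : R, [/\ s != 0, s * s = 1 &
    P *m G *m P^T = s *: eta].
  case: lorP => ->; [exists 1|exists (-1)]; rewrite ?scale1r ?scaleN1r;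
    by rewrite ?oppr_eq0 ?oner_eq0 ?mulrNN ?mulr1.
have uPT : P^T \in unitmx by rewrite unitmx_tr.
(* The matrix in the frame P of the endomorphism X. *)
pose conj X := invmx P^T *m X *m P^T.
have conjM X Y : conj X *m conj Y = conj (X *m Y).
  by rewrite /conj !mulmxA mulmxK.
have conjI X Y : conj X = conj Y -> X = Y.
  rewrite /conj => /(congr1 (mulmxr (invmx P^T))) /=; rewrite !mulmxK //.
  by move=> /(congr1 (mulmx P^T)); rewrite !mulKVmx.
have conjT X : (conj X)^T *m P = P *m X^T.
  by rewrite /conj !trmx_mul trmxK trmx_inv trmxK -!mulmxA mulVmx // mulmx1.
have conj_anti X : (G *m X)^T = - (G *m X) ->
    (eta *m conj X)^T = - (eta *m conj X).
  move=> aX; have E : eta *m conj X = s *: (P *m (G *m X) *m P^T).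
    have -> : eta = s *: (P *m G *m P^T).
      by rewrite GP scalerA ss scale1r.
    rewrite -scalemxAl /conj !mulmxA; congr (_ *: (_ *m _ *m _)).
    by rewrite mulmxK.
  rewrite E linearZ /= [(P *m _ *m _)^T]trmx_mul [(P *m _)^T]trmx_mul trmxK aX.
  by rewrite mulNmx mulmxN scalerN mulmxA.
have conj_der (X : 'M[R]_4) : (forall a b c d,
      derivation 0 1 2 3 (fun i j => X i j) C a b c d = 0) ->
    forall a b c d,
      derivation 0 1 2 3 (fun i j => conj X i j) (frame P C) a b c d = 0.
  move=> dX a b c d; rewrite derivation_slots.
  have [-> -> -> ->] := frame_slot C (conjT X).
  rewrite -!frame_add -[RHS](frame0 P a b c d); congr (frame P _ a b c d).
  do 4!apply/funext => ?; apply: etrans (dX _ _ _ _).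
  by rewrite derivation_slots.
apply: conjI; rewrite -!conjM.
apply: (@minkowski_stabilizer_commute (frame P C)); rewrite ?conj_anti //.
- have [al ar bi] := cC; split=> a b c d.
  + rewrite -[in RHS]frame_swap_l -frame_opp; congr (frame P _ a b c d).
    by do 4!apply/funext => ?; exact: al.
  + rewrite -[in RHS]frame_swap_r -frame_opp; congr (frame P _ a b c d).
    by do 4!apply/funext => ?; exact: ar.
  + have <- := frame_cycle P C a b c d.
    have <- : frame P (fun i j k l => C i l j k) a b c d = frame P C a d b c.
      rewrite -(frame_cycle P C a c d b).
      by rewrite -(frame_cycle P (fun i j k l => C i k l j) a b c d).
    rewrite -!frame_add -[RHS](frame0 P a b c d).
    congr (frame P _ a b c d).
    by do 4!apply/funext => ?; exact: bi.
- move=> b d; rewrite frame_trace.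
  have -> : P^T *m eta *m P = s *: invmx G.
    have : P^T *m eta *m P *m G = s%:M.
      apply: (can_inj (mulmxK uPT)).
      rewrite -!mulmxA (mulmxA P G) GP -!scalemxAr minkowskiK mulmx1.
      by rewrite mul_scalar_mx.
    move=> /(congr1 (mulmxr (invmx G))) /=.
    rewrite mulmxK ?lorentzian_unit // => ->.
    by rewrite mul_scalar_mx.
  apply: big1 => j _; rewrite big1 ?mulr0 // => l _.
  under eq_bigr => i _.
    under eq_bigr do rewrite mxE -mulrA.
    rewrite -mulr_sumr; over.
  by rewrite -mulr_sumr trC !mulr0.
- case: C0 => a [b [c [d]]]; apply: contra_notP => nz.
  rewrite -(frameK C uP) -[RHS](frame0 (invmx P) a b c d).
  congr (frame _ _ a b c d).
  do 4!apply/funext => ?; apply/eqP/negPn/negP => /eqP ne.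
  by apply: nz; do 4!eexists; exact: ne.
- exact: conj_der.
- exact: conj_der.
Qed.

End Stabilizer.

(** * Semi-symmetry *)

Section PointwiseCurvature.
Context {R : realType}.
Variables (G : 'M[R]_4) (rup : 'I_4 -> 'I_4 -> 'I_4 -> 'I_4 -> R).

(* G is the metric at a point and rup a b c d = R^a_bcd; then come the
   covariant Riemann tensor, the Ricci tensor, the scalar curvature and the
   Weyl tensor. *)
Let rdn a b c d := \sum_(e < 4) G a e * rup e b c d.
Let ric a b := \sum_(c < 4) rup c a c b.
Let sc := \sum_(a < 4) \sum_(b < 4) invmx G a b * ric a b.
Let W a b c d := rdn a b c d
  - 2^-1 * (G a c * ric b d - G a d * ric b c - G b c * ric a d + G b d * ric a c)
  + 6^-1 * sc * (G a c * G b d - G a d * G b c).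

Hypothesis lorG : lorentzian G.
Hypothesis curv : curvature_like rdn.

Let symG : G^T = G := lorG.1.
Let uG : G \in unitmx. Proof. exact: lorentzian_unit. Qed.
Let symI : (invmx G)^T = invmx G. Proof. by rewrite trmx_inv symG. Qed.
Let GC a b : G a b = G b a. Proof. by rewrite -{1}symG mxE. Qed.
Let IC a b : invmx G a b = invmx G b a. Proof. by rewrite -{1}symI mxE. Qed.

(* The metric contraction. *)
Let contract (X : 'I_4 -> 'I_4 -> R) :=
  \sum_(p < 4) \sum_(q < 4) invmx G p q * X p q.

Let contractD X Y : contract (fun p q => X p q + Y p q) = contract X + contract Y.
Proof.
rewrite /contract -big_split /=; apply: eq_bigr => p _.
by rewrite -big_split /=; apply: eq_bigr => q _; rewrite mulrDr.
Qed.

Let contractZ k X : contract (fun p q => k * X p q) = k * contract X.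
Proof.
rewrite /contract mulr_sumr; apply: eq_bigr => p _.
by rewrite mulr_sumr; apply: eq_bigr => q _; rewrite mulrCA.
Qed.

Let contract_sum (F : 'I_4 -> 'I_4 -> 'I_4 -> R) :
  contract (fun p q => \sum_(e < 4) F e p q) = \sum_(e < 4) contract (F e).
Proof.
rewrite /contract [RHS]exchange_big /=; apply: eq_bigr => p _.
by rewrite [RHS]exchange_big /=; apply: eq_bigr => q _; rewrite mulr_sumr.
Qed.

Let contractC X : contract (fun p q => X q p) = contract X.
Proof.
rewrite /contract exchange_big /=; apply: eq_bigr => p _.
by apply: eq_bigr => q _; rewrite IC.
Qed.

Let contract_G y d : contract (fun p q => G p d * y q) = y d.
Proof.
rewrite -contractC /contract -[RHS](sum_mul1mx y d); apply: eq_bigr => p _.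
under eq_bigr do rewrite mulrA.
rewrite -mulr_suml -(mulmxV uG) mxE; congr (_ * _).
by apply: eq_bigr => q _; rewrite IC GC mulrC.
Qed.

Let contract_GG : contract G = 4.
Proof.
transitivity (\tr (invmx G *m G)); last by rewrite mulVmx // mxtrace1.
apply: eq_bigr => p _; rewrite mxE; apply: eq_bigr => q _.
by rewrite GC.
Qed.

Let ric_contract a b : ric a b = contract (fun p q => rdn p a q b).
Proof.
rewrite -contractC; apply: eq_bigr => p _.
rewrite (sum_mulmx (invmx G) G (fun e => rup e a p b)) mulVmx //.
by rewrite sum_mul1mx.
Qed.

Let ricC a b : ric a b = ric b a.
Proof.
rewrite !ric_contract -contractC; congr contract.
by do 2!apply/funext => ?; rewrite (curv_pair curv).
Qed.

Lemma weyl_curvature_like : curvature_like W.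
Proof.
have [al ar bi] := curv; split=> a b c d; rewrite /W.
- by rewrite (al a b); ring.
- by rewrite (ar a b); ring.
- rewrite (GC d b) (GC d c) (GC c b) (ricC d b) (ricC d c) (ricC c b).
  by rewrite -[RHS](bi a b c d); ring.
Qed.

Lemma weyl_trace_free b d :
  \sum_(a < 4) \sum_(c < 4) invmx G a c * W a b c d = 0.
Proof.
rewrite -/(contract (fun a c => W a b c d)).
transitivity (contract (fun a c => rdn a b c d
   + (((- 2^-1 * ric b d + 6^-1 * sc * G b d) * G a c
   + (- 2^-1 * G b d) * ric a c)
   + (2^-1 * (G a d * ric b c) + (2^-1 * (G c b * ric a d)
   + (- 6^-1 * sc) * (G a d * G b c)))))).
  by congr contract; do 2!apply/funext => ?; rewrite /W (GC b); ring.
rewrite !contractD !contractZ -ric_contract contract_GG.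
rewrite (contract_G (ric b)) (contract_G (G b)).
rewrite (contractC (fun c a => G c b * ric a d)) (contract_G (fun a => ric a d)).
have -> : contract (fun a c => ric a c) = sc by [].
by field.
Qed.

(* The curvature endomorphisms. *)
Let A a b : 'M[R]_4 := \matrix_(e, i) rup e i a b.

Let GA a b : G *m A a b = \matrix_(e, i) rdn e i a b.
Proof.
by apply/matrixP => e i; rewrite !mxE; apply: eq_bigr => k _; rewrite mxE.
Qed.

Let GA_anti a b : (G *m A a b)^T = - (G *m A a b).
Proof.
by rewrite GA; apply/matrixP => e i; rewrite !mxE (curv_antisym_l curv).
Qed.

Hypothesis W0 : exists a b c d, W a b c d <> 0.
Hypothesis dW : forall i j a b c d,
  derivation 0 1 2 3 (fun e f => rup e f i j) W a b c d = 0.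

Let dWA i j a b c d : derivation 0 1 2 3 (fun e f => A i j e f) W a b c d = 0.
Proof.
rewrite -[RHS](dW i j a b c d); congr (derivation _ _ _ _ _ W a b c d).
by do 2!apply/funext => ?; rewrite mxE.
Qed.

Lemma curvature_commute a b c d : A a b *m A c d = A c d *m A a b.
Proof.
exact: (stabilizer_commute lorG weyl_curvature_like weyl_trace_free W0
  (GA_anti a b) (GA_anti c d) (dWA a b) (dWA c d)).
Qed.

(** The terms of [A_ab . R_pcqd] in which [A_ab] hits the first pair of indices
    form the commutator of [A_ab] and [A_qd]. *)
Lemma curvature_act_riemann a b p c q d :
  \sum_(e < 4) rup e p a b * rdn e c q d +
  \sum_(e < 4) rup e c a b * rdn p e q d = 0.
Proof.
have -> : \sum_(e < 4) rup e p a b * rdn e c q d =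
    ((A a b)^T *m (G *m A q d)) p c.
  by rewrite GA [RHS]mxE; apply: eq_bigr => e _; rewrite !mxE.
have -> : \sum_(e < 4) rup e c a b * rdn p e q d = (G *m A q d *m A a b) p c.
  by rewrite GA [RHS]mxE; apply: eq_bigr => e _; rewrite !mxE mulrC.
have -> : (A a b)^T *m (G *m A q d) = - (G *m A a b *m A q d).
  by rewrite mulmxA -{1}symG -trmx_mul GA_anti mulNmx.
by rewrite -!mulmxA curvature_commute mxE addNr.
Qed.

(** The contraction in [p], [q] of [A_ab . R_pcqd = 0].  The terms in which
    [A_ab] hits [p] or [q] cancel, since [A_ab] preserves the inverse metric;
    the other two form [A_ab . R_cd]. *)
Lemma ricci_semi_symmetric_algebra a b c d :
  \sum_(e < 4) rup e c a b * ric e d + \sum_(e < 4) rup e d a b * ric c e = 0.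
Proof.
pose M := A a b *m invmx G.
have antiM e p : M e p = - M p e.
  have -> : M = invmx G *m (G *m A a b) *m invmx G by rewrite mulKmx.
  set N := _ *m _ *m _; have : N^T = - N.
    by rewrite /N !trmx_mul symI -trmx_mul GA_anti mulNmx mulmxN mulmxA.
  by move=> /matrixP/(_ p e); rewrite !mxE.
have eI : \sum_(e < 4) contract (fun p q => rup e p a b * rdn e c q d) =
    \sum_(e < 4) \sum_(q < 4) M e q * rdn e c q d.
  apply: eq_bigr => e _; rewrite -contractC /contract.
  under [RHS]eq_bigr do rewrite mxE mulr_suml.
  apply: eq_bigr => q _; apply: eq_bigr => p _.
  by rewrite mxE IC mulrCA mulrA.
have eIII : \sum_(e < 4) contract (fun p q => rup e q a b * rdn e d p c) =
    - \sum_(e < 4) \sum_(q < 4) M e q * rdn e c q d.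
  rewrite [X in - X]exchange_big /= -sumrN; apply: eq_bigr => e _.
  rewrite /contract -sumrN; apply: eq_bigr => p _.
  rewrite antiM mulNr opprK mxE mulr_suml; apply: eq_bigr => q _.
  by rewrite mxE IC (curv_pair curv e d) mulrCA mulrA.
have : contract (fun p q =>
    (\sum_(e < 4) rup e p a b * rdn e c q d +
     \sum_(e < 4) rup e c a b * rdn p e q d)
    + (\sum_(e < 4) rup e q a b * rdn e d p c +
       \sum_(e < 4) rup e d a b * rdn q e p c)) = 0.
  rewrite /contract big1 // => p _; rewrite big1 // => q _.
  by rewrite !curvature_act_riemann addr0 mulr0.
rewrite !contractD.
rewrite (contract_sum (fun e p q => rup e p a b * rdn e c q d)) eI.
rewrite (contract_sum (fun e p q => rup e q a b * rdn e d p c)) eIII.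
rewrite addrACA subrr add0r => E0; rewrite -[RHS]E0; congr (_ + _).
  rewrite (contract_sum (fun e p q => rup e c a b * rdn p e q d)).
  by apply: eq_bigr => e _; rewrite contractZ -ric_contract.
rewrite (contract_sum (fun e p q => rup e d a b * rdn q e p c)).
apply: eq_bigr => e _; rewrite contractZ (contractC (fun p q => rdn p e q c)).
by rewrite -ric_contract ricC.
Qed.

End PointwiseCurvature.

(** The statement at one point of one chart. *)
Lemma ricci_semi_symmetric_chart (R : realType) (g : 'rV[R]_4 -> 'M[R]_4)
    (U : set 'rV[R]_4) x :
  open U -> (forall i j, smooth_on U (fun y => g y i j)) ->
  (forall y, U y -> lorentzian (g y)) -> U x ->
  (exists I : 4.-tuple 'I_4, weyl_tensor g I x <> 0) ->
  (forall a b c d e f,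
     nabla_antisym g (weyl_tensor g) a b [tuple c; d; e; f] x = 0) ->
  forall a b c d, nabla_antisym g (ricci_tensor g) a b [tuple c; d] x = 0.
Proof.
move=> oU sg lor Ux [I WI] dW a b c d.
have symg y : U y -> (g y)^T = g y by move=> /lor[].
have unitg y : U y -> g y \in unitmx by move=> /lor/lorentzian_unit.
have sG := smooth_christoffel oU sg unitg.
have GC := christoffelC oU symg.
have half0 : - 2^-1 != 0 :> R by rewrite oppr_eq0 invr_eq0 pnatr_eq0.
have curv : curvature_like (fun a b c d => riemann g a b c d x).
  split=> *; [exact: (riemann_antisym_l oU sg symg unitg)
             |exact: riemann_antisym_r|exact: (riemann_bianchi oU symg)].
rewrite (ricci_identity oU sG GC) //; last by move=> J; exact: smooth_ricci.
rewrite (act2 _ (fun i j => ricci g i j x)) /=.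
apply/eqP; rewrite mulf_eq0 (negbTE half0) /=; apply/eqP.
apply: (ricci_semi_symmetric_algebra (lor _ Ux) curv).
  by exists (tnth I 0), (tnth I 1), (tnth I 2), (tnth I 3).
move=> i j {}a {}b {}c {}d; have := dW i j a b c d.
rewrite (ricci_identity oU sG GC) //; last by move=> J; exact: smooth_weyl.
move=> /eqP; rewrite mulf_eq0 (negbTE half0) /= => /eqP.
rewrite (act4 _ (fun i j k l => weyl g i j k l x)) sum_ord4.
exact.
Qed.

Theorem lemma2 (R : realType) (M : manifold R) (g : lorentz_metric M)
    (weyl_neq0 : weyl_nonzero_everywhere g)
    (conf_semi_sym : conformally_semi_symmetric g) :
  ricci_semi_symmetric g.
Proof.
move=> p ch ach pch a b c d.
apply: (ricci_semi_symmetric_chart (@chart_im_open _ _ ch)).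
- exact: metric_smooth.
- exact: metric_lorentzian.
- exact: chart_map_im.
- exact: weyl_neq0 pch.
- exact: conf_semi_sym pch.
Qed.
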